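(* Let \[ \mathcal{E}_d:=\{ f\in\mathrm{End}_d^2 : \mathcal{C}_f \text{ is smooth and irreducible}\}. \] (a) For $d\ge1$, $\mathcal{E}_d$ is a non-empty Zariski open subset of $\mathrm{End}_d^2$. (b) For $d\ge2$, $\mathcal{E}_d$ contains no post-critically periodic maps. (c) For all $d\ge2$, the set $\{f\in\mathrm{End}_d^2 : f \text{ is post-critically periodic}\}$ is not Zariski dense in $\mathrm{End}_d^2$.
   Context: Work over an algebraically closed field $\mathbb{F}$ of characteristic $0$. $\mathrm{End}_d^n$ is the set of morphisms $f:\mathbb{P}^n\to\mathbb{P}^n$ of algebraic degree $d$ (i.e. $f=[f_0:\dots:f_n]$, $f_i$ homogeneous of degree $d$ with no common zero), viewed as a Zariski open subset of $\mathbb{P}^N$, $N=(n+1)\binom{d+n}{n}-1$. The critical locus is $\mathcal{C}_f=\{\det(\partial f_i/\partial x_j)=0\}$. A map $f$ is post-critically periodic if $f^k(\mathcal{C}_f)\subseteq\mathcal{C}_f$ for some $k\ge1$. *)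

(* Defs.v *)
From HB Require Import structures.
From mathcomp Require Import all_boot all_algebra.
From mathcomp Require Import mpoly.

Set Implicit Arguments.
Unset Strict Implicit.
Unset Printing Implicit Defensive.

Import GRing.Theory.
Local Open Scope ring_scope.

Section Defs.
Variable F : closedFieldType.

(* A point of the affine cone over P^(n-1): a vector of F^n, as 'I_n -> F. *)
Definition nonzero_pt (n : nat) (x : 'I_n -> F) : Prop := exists i, x i != 0.

(* Zariski closed subset of P^(n-1), described on the (scaling-invariant) cone:
   common zero locus (among nonzero vectors) of a set S of homogeneous
   polynomials in n variables. *)
Definition homog_set (n : nat) (S : {mpoly F[n]} -> Prop) : Prop :=
  forall p, S p -> exists k : nat, p \is k.-homog.

Definition zero_locus (n : nat) (S : {mpoly F[n]} -> Prop) (x : 'I_n -> F) : Prop :=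
  nonzero_pt x /\ forall p, S p -> p.@[x] = 0.

Definition proj_closed (n : nat) (A : ('I_n -> F) -> Prop) : Prop :=
  exists S, homog_set S /\ forall x, A x <-> zero_locus S x.

(* Irreducibility of a subset Z of P^(n-1) for the induced Zariski topology:
   Z is not the union of two proper relatively closed subsets.  (No
   non-emptiness requirement.) *)
Definition proj_irreducible (n : nat) (Z : ('I_n -> F) -> Prop) : Prop :=
  forall A B, proj_closed A -> proj_closed B ->
    (forall x, Z x -> A x \/ B x) ->
    (forall x, Z x -> A x) \/ (forall x, Z x -> B x).

Definition triple := 'I_3 -> {mpoly F[3]}.

(* f is a morphism P^2 -> P^2 of algebraic degree d:
   each f_i homogeneous of degree d and no common zero in P^2. *)
Definition End2 (d : nat) (f : triple) : Prop :=
  (forall i, f i \is d.-homog) /\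
  (forall x : 'I_3 -> F, nonzero_pt x -> exists i, (f i).@[x] != 0).

Definition fapp (f : triple) (x : 'I_3 -> F) : 'I_3 -> F := fun i => (f i).@[x].

Definition jacdet (f : triple) : {mpoly F[3]} :=
  \det (\matrix_(i < 3, j < 3) (f i)^`M(j)).

Definition crit_locus (f : triple) (x : 'I_3 -> F) : Prop :=
  nonzero_pt x /\ (jacdet f).@[x] = 0.

(* C_f is smooth: the defining polynomial has nonvanishing gradient at every
   point of the curve (Jacobian criterion). *)
Definition crit_smooth (f : triple) : Prop :=
  forall x, crit_locus f x -> exists j : 'I_3, ((jacdet f)^`M(j)).@[x] != 0.

Definition crit_irreducible (f : triple) : Prop :=
  proj_irreducible (crit_locus f).

Definition postcrit_periodic (f : triple) : Prop :=
  exists2 k : nat, (1 <= k)%N &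
    forall x, crit_locus f x -> crit_locus f (iter k (fapp f) x).

Definition Ed (d : nat) (f : triple) : Prop :=
  End2 d f /\ crit_smooth f /\ crit_irreducible f.

(* Homogeneous coordinates of End_d^2 inside P^N: the coefficients of the f_i
   at the monomials of degree d (there are N+1 = 3 * binom(d+2,2) of them). *)
Definition cidx (d : nat) : finType :=
  ('I_3 * {m : 'X_{1..3 < d.+1} | mdeg m == d})%type.

Definition coords (d : nat) (f : triple) : 'I_#|cidx d| -> F :=
  fun k => let: (i, m) := enum_val k in (f i)@_(val (val m)).

(* U is a Zariski open subset of End_d^2 (for the topology induced from P^N). *)
Definition open_in_End (d : nat) (U : triple -> Prop) : Prop :=
  (forall f, U f -> End2 d f) /\
  exists S : {mpoly F[#|cidx d|]} -> Prop, homog_set S /\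
    forall f, End2 d f -> (U f <-> exists2 P, S P & P.@[@coords d f] != 0).

Definition dense_in_End (d : nat) (A : triple -> Prop) : Prop :=
  forall U, open_in_End d U -> (exists f, U f) -> exists f, U f /\ A f.

End Defs.

(* Main.v *)
(* Let J = det Df, a form of degree m = 3(d - 1), and g = grad J.

   If J = 0 is smooth, then J is prime, because two components of a plane curve
   meet, and they meet in a singular point.  This rests on one principle: if
   N_i, G_i are forms of the same degree whose ratio N/G is a well-defined
   regular function on the curve, then N/G is constant.  Indeed N/G acts on the
   forms of large degree modulo J, and is an eigenvalue of that action.

   Suppose that F = f^k maps the critical curve into itself.  The section
   cof(Df) g has a zero x1 on the curve, since otherwise the cofactors of Df
   divided by it would be constant.  Differentiating J o F = q J shows that
   N = cof(DF) g is proportional to G = g(F), which never vanishes.  As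
   deg N <= deg G and N(x1) = 0, N vanishes identically on the curve, i.e. the
   derivative of F along the curve is zero.  In characteristic 0 the ratios
   F_i/F_j are then constant on the curve, which is absurd because F_j has a
   zero there.

   Smoothness is an open condition: grad J has no zero if and only if some
   Macaulay matrix of grad J has full rank.  It is satisfied by
   f_i = x_i (e x_i^e + d (x_0^e + x_1^e + x_2^e)) with e = d - 1. *)

Require Import Defs.
From HB Require Import structures.
From mathcomp Require Import all_boot all_algebra.
From mathcomp Require Import mpoly.
From mathcomp Require Import perm ring zify.
From Stdlib Require Import Classical.

Set Implicit Arguments.
Unset Strict Implicit.
Unset Printing Implicit Defensive.

Import GRing.Theory.
Local Open Scope ring_scope.

(** * Unique factorization in polynomial rings *)

(** The matrix cof(A) sends the normal of a plane to the normal of its image under A. On the curve J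
    = 0 the section cof(Df) g therefore vanishes exactly where f restricted to the curve has
    derivative zero, and if F preserves the curve then cof(DF) g must be proportional to the normal
    g(F) at the image point. The factor of proportionality is the derivative of the self-map of the
    curve. With D = deg F its degree is 2(D - 1) + (m - 1) - (m - 1)D = -(D - 1)(m - 3), where m - 3
    is the degree of the canonical bundle; it is at most 0 because d >= 2 gives m >= 3. A section of
    such a degree that has a zero is zero: this takes the place of the Hurwitz formula and of any
    genus.

    Irreducibility of the curve is used as primality of J, so that a product vanishing on the curve
    has a factor vanishing there. This is why factoriality of polynomial rings comes first;
    pseudo-division stands in for fraction fields and resultants throughout. *)

Section Divisibility.
Variable R : idomainType.
Implicit Types a b c p : R.

Definition rdvd a b := exists c, b = c * a.

Definition rprime p :=
  [/\ p != 0, p \isn't a GRing.unit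
    & forall a b, rdvd p (a * b) -> rdvd p a \/ rdvd p b].

Definition rirred p :=
  [/\ p != 0, p \isn't a GRing.unit
    & forall a b, p = a * b -> a \is a GRing.unit \/ b \is a GRing.unit].

Inductive prime_product : R -> Prop :=
| PrimeProductUnit u : u \is a GRing.unit -> prime_product u
| PrimeProductMul p a : rprime p -> prime_product a -> prime_product (p * a).

Lemma rdvdD a b c : rdvd a b -> rdvd a c -> rdvd a (b + c).
Proof. by move=> [x ->] [y ->]; exists (x + y); rewrite mulrDl. Qed.

Lemma rdvdN a b : rdvd a b -> rdvd a (- b).
Proof. by move=> [x ->]; exists (- x); rewrite mulNr. Qed.

Lemma rdvdB a b c : rdvd a b -> rdvd a c -> rdvd a (b - c).
Proof. by move=> ab ac; apply: rdvdD => //; apply: rdvdN. Qed.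

Lemma rdvd_mull a b c : rdvd a b -> rdvd a (c * b).
Proof. by move=> [x ->]; exists (c * x); rewrite mulrA. Qed.

Lemma rdvd_mulr a b c : rdvd a b -> rdvd a (b * c).
Proof. by rewrite mulrC; apply: rdvd_mull. Qed.

Lemma rdvd_refl a : rdvd a a. Proof. by exists 1; rewrite mul1r. Qed.

Lemma rdvd0 a : rdvd a 0. Proof. by exists 0; rewrite mul0r. Qed.

Lemma rdvd_sum (I : Type) (r : seq I) (P : pred I) (f : I -> R) a :
  (forall i, P i -> rdvd a (f i)) -> rdvd a (\sum_(i <- r | P i) f i).
Proof. by move=> h; elim/big_ind: _ => //; [apply: rdvd0 | apply: rdvdD]. Qed.

Lemma rprime_exp p a n : rprime p -> rdvd p (a ^+ n) -> rdvd p a.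
Proof.
move=> [p0 pu pp]; elim: n => [|n IH]; last by rewrite exprS => /pp [].
rewrite expr0 => -[c c1]; case/negP: pu; apply/unitrP; exists c.
by rewrite [p * c]mulrC -c1.
Qed.

Lemma rprime_prod (I : Type) (r : seq I) (f : I -> R) p :
  rprime p -> rdvd p (\prod_(i <- r) f i) -> exists i, rdvd p (f i).
Proof.
move=> [p0 pu pp]; elim: r => [|i r IH].
  rewrite big_nil => -[c c1]; case/negP: pu; apply/unitrP; exists c.
  by rewrite [p * c]mulrC -c1.
by rewrite big_cons => /pp [pi|/IH //]; exists i.
Qed.

(** Irreducibility makes everything after the first prime of the product a unit, and primality is
    insensitive to units. *)
Lemma rirred_prime_product p : prime_product p -> rirred p -> rprime p.
Proof.
move=> [u uu [_ /negP []//]|q a qprime _ [qa0 qau /(_ q a erefl)]].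
have [q0 qu qq] := qprime; rewrite (negPf qu) => -[//|ua].
split=> // x y.
have dvE z : rdvd (q * a) z <-> rdvd q z.
  split=> -[c ->]; first by exists (c * a); ring.
  by exists (c * a^-1); rewrite mulrACA mulVr // mulr1.
by rewrite !dvE; apply: qq.
Qed.

End Divisibility.

(** * Gauss's lemma by pseudo-division *)

Section Gauss.
Variable R : idomainType.
Implicit Types f g h w : {poly R}.

Lemma rdvd_polyC (c : R) f : (forall i, rdvd c f`_i) -> rdvd c%:P f.
Proof.
move=> h; have hh i : exists d, f`_i == d * c.
  by have [d ->] := h i; exists d.
exists (\poly_(i < size f) xchoose (hh i)); apply/polyP=> i.
rewrite coefMC coef_poly; case: ltnP => [_|hi]; last by rewrite mul0r nth_default.
exact/eqP/(xchooseP (hh i)).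
Qed.

Lemma coef_rdvd_polyC (c : R) f i : rdvd c%:P f -> rdvd c f`_i.
Proof. by move=> [q ->]; rewrite coefMC; exists q`_i. Qed.

(** Both factors are peeled from their constant terms. The product of these is divisible by [p], so
    one of them is; subtracting its share leaves a multiple of ['X], which can be cancelled. *)
Lemma rprime_polyC (p : R) : rprime p -> rprime p%:P.
Proof.
move=> [p0 pu pp]; split; first by rewrite polyC_eq0.
  apply/negP; rewrite poly_unitE => /andP[_]; rewrite coefC eqxx.
  by apply/negP.
have shift f : rdvd p%:P (f * 'X) -> rdvd p%:P f.
  move=> h; apply: rdvd_polyC => i.
  by have := coef_rdvd_polyC i.+1 h; rewrite coefMX.
have cst (c : R) : rdvd p c -> rdvd p%:P c%:P.
  by move=> [d ->]; exists d%:P; rewrite polyCM.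
elim/poly_ind => [g|f c IHf]; first by left; apply: rdvd0.
elim/poly_ind => [|g d IHg] dv; first by right; apply: rdvd0.
have /pp [pc|pd] : rdvd p (c * d).
  have := coef_rdvd_polyC 0 dv; rewrite coef0M !coefD !coefMX !coefC /=.
  by rewrite !add0r.
- have /IHf [pf|] : rdvd p%:P (f * (g * 'X + d%:P)); last by right.
    apply: shift; have := rdvdB dv (rdvd_mulr (g * 'X + d%:P) (cst _ pc)).
    by congr rdvd; ring.
  by left; apply: rdvdD; [apply: rdvd_mulr|apply: cst].
- have /IHg [pf|pg] : rdvd p%:P ((f * 'X + c%:P) * g); last 1 first.
  + by right; apply: rdvdD; [apply: rdvd_mulr|apply: cst].
  + apply: shift; have := rdvdB dv (rdvd_mull (f * 'X + c%:P) (cst _ pd)).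
    by congr rdvd; ring.
  by left.
Qed.

(** Replaces the generator of an ideal over the fraction field: the pseudo-remainder by an element
    of least size is again in [I], hence zero. *)
Lemma min_size_generator (I : {poly R} -> Prop) :
    (forall a b, I a -> I b -> I (a + b)) -> (forall a b, I b -> I (a * b)) ->
    (exists2 w, I w & w != 0) ->
  exists w, [/\ I w, w != 0
    & forall h, I h -> exists k q, lead_coef w ^+ k *: h = q * w].
Proof.
move=> ID IM [w0 Iw0 nzw0].
have [n le_n] := ubnP (size w0); elim: n w0 Iw0 nzw0 le_n => // n IH w Iw nzw le_w.
case: (classic (exists2 v, I v & v != 0 /\ (size v < size w)%N)) => [|no].
  by move=> [v Iv [nzv lt_v]]; apply: (IH v) => //; lia.
exists w; split=> // h Ih; exists (scalp h w), (h %/ w).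
have := Pdiv.Idomain.divp_eq h w.
have [->|nzr] := eqVneq (h %% w) 0; first by rewrite addr0.
move=> e; case: no; exists (h %% w); last by rewrite nzr ltn_modp.
have -> : h %% w = (lead_coef w ^+ scalp h w)%:P * h + (- (h %/ w)) * w.
  by rewrite mul_polyC e; ring.
by apply: ID; apply: IM.
Qed.

Hypothesis factR : forall a : R, a != 0 -> prime_product a.

(** The primes of [c] are removed one at a time: such a prime cannot divide [f], which is
    irreducible and nonconstant, so it divides the cofactor. *)
Lemma rdvd_scaler_irred (c : R) f h :
  rirred f -> (1 < size f)%N -> c != 0 -> rdvd f (c *: h) -> rdvd f h.
Proof.
move=> [f0 fu fi] sf /factR pc; elim: pc h => {c} [u uu|p a pprime _ IH] h [k hk].
  exists (u^-1 *: k); rewrite -scalerAl -hk scalerA mulVr ?scale1r //.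
have [p0 pu _] := pprime.
have [_ _ /(_ f k)] := rprime_polyC pprime; case.
- by exists (a *: h); rewrite mulrC -hk -!mul_polyC polyCM; ring.
- move=> [q fq]; have := fi q p%:P fq; rewrite !poly_unitE => -[|].
    case/andP=> /eqP sq _; move: sf; rewrite fq mulrC mul_polyC.
    by rewrite size_scale // sq.
  by rewrite coefC eqxx (negPf pu) andbF.
- move=> [q kq]; apply: IH; exists q.
  have := hk; rewrite kq -scalerA => e.
  apply: (@mulfI _ p%:P); first by rewrite polyC_eq0.
  by rewrite mul_polyC e; ring.
Qed.

(* The constant [c] is distributed, prime by prime, over the two factors. *)
Lemma scale_factorization (c : R) f q w :
    c != 0 -> c *: f = q * w ->
  exists q' w' e, [/\ f = q' * w', size w' = size w & w = e *: w'].
Proof.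
move=> /factR pc; elim: pc q w => {c} [u uu|p a pprime _ IH] q w e.
  exists (u^-1 *: q), w, 1; rewrite scale1r; split=> //.
  by rewrite -scalerAl -e scalerA mulVr ?scale1r.
have [p0 pu _] := pprime; have pP0 : p%:P != 0 by rewrite polyC_eq0.
have [_ _ /(_ q w)] := rprime_polyC pprime; case.
- by exists (a *: f); rewrite -e -!mul_polyC polyCM; ring.
- move=> [v qv]; apply: (IH v w); apply: (mulfI pP0).
  by rewrite mul_polyC scalerA e qv; ring.
- move=> [v wv]; have [|q' [w' [x [fE sw vE]]]] := IH q v.
    by apply: (mulfI pP0); rewrite mul_polyC scalerA e wv; ring.
  exists q', w', (p * x); split=> //.
    by rewrite sw wv mulrC mul_polyC size_scale.
  by rewrite wv mulrC mul_polyC {1}vE scalerA.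
Qed.

(** Let [f] divide [g * h] and let [w] be the pseudo-generator of the ideal (f, g). If [w] is a
    constant, its Bezout relation times [h] shows that [f] divides [w * h], hence [h]. Otherwise [w]
    carries a nonconstant factor of [f], hence all of [f], and [f] divides [g]. *)
Lemma rirred_poly_prime f : rirred f -> rprime f.
Proof.
move=> irf; have [f0 fu fi] := irf.
have [sf|] := leqP (size f) 1.
  have fC := size1_polyC sf; rewrite fC; apply: rprime_polyC.
  have f00 : f`_0 != 0 by apply: contraNneq f0 => e; rewrite fC e.
  apply: rirred_prime_product; first exact: factR.
  split=> //.
    by move: fu; rewrite fC poly_unitE size_polyC coefC eqxx f00.
  move=> a b ab; have := fi a%:P b%:P; rewrite -polyCM -ab -fC => /(_ erefl).
  by rewrite !poly_unitE !coefC !eqxx /=; case=> /andP[_ ?]; [left|right].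
move=> sf; split=> // g h [k ghk].
pose I w := exists a b, w = a * f + b * g.
have [|||w [[a [b wab]] nzw wmin]] := @min_size_generator I.
- by move=> x y [a [b ->]] [c [d ->]]; exists (a + c), (b + d); ring.
- by move=> x y [a [b ->]]; exists (x * a), (x * b); ring.
- by exists f => //; exists 1, 0; ring.
have lw : lead_coef w != 0 by rewrite lead_coef_eq0.
have [sw|sw] := leqP (size w) 1.
  right; have wC := size1_polyC sw.
  have w0 : w`_0 != 0 by apply: contraNneq nzw => e; rewrite wC e.
  apply: (rdvd_scaler_irred irf sf w0); exists (a * h + b * k).
  by rewrite -mul_polyC -wC wab mulrDl -[b * g * h]mulrA ghk; ring.
have [|m [q e]] := wmin f; first by exists 1, 0; ring.
have [q' [w' [x [fE sw' wE]]]] := scale_factorization (expf_neq0 m lw) e.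
left; case: (fi _ _ fE) => [uq|]; last first.
  by rewrite poly_unitE sw'; case/andP => /eqP e1; rewrite e1 in sw.
have [|m' [r e']] := wmin g; first by exists 0, 1; ring.
apply: (rdvd_scaler_irred irf sf (expf_neq0 m' lw)).
exists (r * (x *: q'^-1)); rewrite e' wE fE -!mul_polyC.
rewrite -[w' in LHS]mul1r -[in LHS](mulVr uq); ring.
Qed.

End Gauss.

(** Plays the role of a resultant. Were the pseudo-generator [w] of (f, g) nonconstant, [f] would
    divide [q] or [w] in a relation between a scalar multiple of [f] and [q * w]. The first makes
    [w] divide a nonzero constant, the second makes [f] divide a scalar multiple of [g]. *)
Lemma rprime_eliminant (R : idomainType) (f g : {poly R}) :
    rprime f -> (1 < size f)%N -> ~ rdvd f g ->
  exists a b c, c != 0 /\ c%:P = a * f + b * g.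
Proof.
move=> [f0 fu fp] sf nfg.
pose I w := exists a b, w = a * f + b * g.
have [|||w [[a [b wab]] nzw wmin]] := @min_size_generator _ I.
- by move=> x y [a [b ->]] [c [d ->]]; exists (a + c), (b + d); ring.
- by move=> x y [a [b ->]]; exists (x * a), (x * b); ring.
- by exists f => //; exists 1, 0; ring.
have lw k : lead_coef w ^+ k != 0 by rewrite expf_neq0 ?lead_coef_eq0.
have [sw|sw] := leqP (size w) 1.
  have wC := size1_polyC sw; exists a, b, w`_0; rewrite -wC; split=> //.
  by apply: contraNneq nzw => e; rewrite wC e.
have [|m [q e]] := wmin f; first by exists 1, 0; ring.
have [|m' [r e']] := wmin g; first by exists 0, 1; ring.
have [|[q' qE]|fw] := fp q w.
- by exists ((lead_coef w ^+ m)%:P); rewrite mul_polyC.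
- have xE : (lead_coef w ^+ m)%:P = q' * w.
    by apply: (mulfI f0); rewrite mulrC mul_polyC e qE; ring.
  have nzq' : q' != 0.
    by apply: contraNneq (lw m) => x0; rewrite -polyC_eq0 xE x0 mul0r.
  move: (congr1 (fun p : {poly R} => size p) xE).
  rewrite size_polyC lw size_mul //.
  by move: nzq'; rewrite -size_poly_gt0; lia.
- have /fp [[x xE]|//] : rdvd f ((lead_coef w ^+ m')%:P * g).
    by rewrite mul_polyC e'; apply: rdvd_mull.
  have nzx : x != 0.
    by apply: contraNneq (lw m') => x0; rewrite -polyC_eq0 xE x0 mul0r.
  move: (congr1 (fun p : {poly R} => size p) xE).
  rewrite size_polyC lw size_mul //.
  by move: nzx; rewrite -size_poly_gt0; lia.
Qed.

(** * Several variables, by isolating the last one *)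

Section MpolyRing.
Variable F : fieldType.

Section Muni.
Variable n : nat.
Implicit Types p q : {mpoly F[n.+1]}.

Lemma muni_mwidenX (m : 'X_{1..n}) k :
  muni ('X_[mnmwiden m] * 'X_ord_max ^+ k : {mpoly F[n.+1]}) = 'X_[m] *: 'X^k.
Proof.
rewrite mpolyXn -mpolyXD muniE msuppX big_seq1 mcoeffX eqxx scale1r.
congr (_ *: 'X^_).
  congr mpolyX; apply/mnmP=> i; rewrite mnmE mnmDE mulmnE mnm1E mnmwiden_widen.
  by rewrite -val_eqE /= gtn_eqF ?addn0 ?ltn_ord.
by rewrite mnmDE mulmnE mnm1E eqxx mul1n mnmwiden_ordmax.
Qed.

Lemma muni_mwiden (c : {mpoly F[n]}) : muni (mwiden c) = c%:P.
Proof.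
elim/mpolyind: c => [|c m p _ _ IH]; first by rewrite mwiden0 muni0.
rewrite mwidenD muniD IH mwidenZ muniZ mwidenX polyCD; congr (_ + _).
have := muni_mwidenX m 0; rewrite expr0 mulr1 => ->.
by rewrite expr0 alg_polyC -mul_polyC -polyCM mul_mpolyC.
Qed.

Lemma muniX : muni ('X_ord_max : {mpoly F[n.+1]}) = 'X.
Proof.
have := muni_mwidenX 0 1; rewrite expr1 mnmwiden0 mpolyX0 mul1r => ->.
by rewrite mpolyX0 scale1r.
Qed.

Lemma mmultiK : cancel (@mmulti n F) (@muni n F).
Proof.
move=> p; rewrite /mmulti raddf_sum /= -[RHS]coefK poly_def.
apply: eq_bigr => i _; rewrite muniM rmorphXn /= muniX muni_mwiden.
by rewrite mul_polyC.
Qed.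

Lemma muni_inj : injective (@muni n F).
Proof.
move=> p q e; apply/mpolyP=> m.
pose res (u : 'X_{1..n.+1}) := [multinom u (widen_ord (leqnSn n) i) | i < n].
have resE m' : (m' == m) = (res m' == res m) && (m ord_max == m' ord_max).
  apply/eqP/andP=> [->|[/eqP/mnmP e' /eqP em]]; first by split; apply/eqP.
  apply/mnmP=> i; case: (unliftP ord_max i) => [j ->|->//].
  have := e' j; rewrite !mnmE; congr (m' _ = m _); apply: val_inj;
    by rewrite /= /bump leqNgt ltn_ord.
have key r : r@_m = ((muni r)`_(m ord_max))@_(res m).
  rewrite muniE coef_sum raddf_sum {1}[r]mpolyE raddf_sum /=.
  apply: eq_bigr => m' _; rewrite mcoeffZ mcoeffX coefZ coefXn.
  by rewrite mulr_natr mcoeffMn mcoeffZ mcoeffX -mulrnAr -mulrnA mulnb resE.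
by rewrite !key e.
Qed.

Lemma muni_unit p : (muni p \is a GRing.unit) = (p \is a GRing.unit).
Proof.
apply/idP/idP=> [/unitrP [q [qp pq]]|]; last exact: rmorph_unit.
apply/unitrP; exists (mmulti q); split; apply: muni_inj;
  by rewrite muniM mmultiK muni1.
Qed.

Lemma rdvd_muni p q : rdvd (muni p) (muni q) <-> rdvd p q.
Proof.
split=> -[c e]; last by exists (muni c); rewrite e muniM.
by exists (mmulti c); apply: muni_inj; rewrite muniM mmultiK.
Qed.

Lemma muni_eq0 p : (muni p == 0) = (p == 0).
Proof. by rewrite -(inj_eq muni_inj) muni0. Qed.

Lemma rprime_muni p : rprime (muni p) <-> rprime p.
Proof.
split=> -[p0 pu pp]; split; rewrite ?muni_eq0 ?muni_unit -?muni_eq0 -?muni_unit //.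
- by move=> a b; rewrite -!rdvd_muni muniM; apply: pp.
- by rewrite muni_eq0.
- by rewrite muni_unit.
- by move=> a b; have := pp (mmulti a) (mmulti b); rewrite -!rdvd_muni muniM !mmultiK.
Qed.

Lemma rirred_muni p : rirred p -> rirred (muni p).
Proof.
move=> [p0 pu pp]; split; rewrite ?muni_eq0 ?muni_unit // => a b e.
have := pp (mmulti a) (mmulti b); rewrite -!muni_unit !mmultiK; apply.
by apply: muni_inj; rewrite e muniM !mmultiK.
Qed.

Lemma mderiv_mwiden (c : {mpoly F[n]}) : (mwiden c)^`M(ord_max) = 0.
Proof.
elim/mpolyind: c => [|c m p _ _ IH]; first by rewrite mwiden0 mderiv0.
by rewrite mwidenD mderivD IH mwidenZ mderivZ mwidenX mderivX mnmwiden_ordmax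
  scale0r scaler0 addr0.
Qed.

(** In the eliminations below, a nonzero partial derivative is what certifies positive degree in the
    last variable. *)
Lemma size_muni_gt1 p : p^`M(ord_max) != 0 -> (1 < size (muni p))%N.
Proof.
apply: contraNltn => sp; have e := size1_polyC sp.
have -> : p = mwiden (muni p)`_0 by apply: muni_inj; rewrite muni_mwiden.
by rewrite mderiv_mwiden.
Qed.

Lemma meval_muni p x :
  p.@[x] = (map_poly (meval (x \o widen_ord (leqnSn n))) (muni p)).[x ord_max].
Proof.
elim/mpolyind: p => [|c m p _ _ IH]; first by rewrite muni0 map_poly0 horner0 meval0.
rewrite mevalD IH muniD [map_poly _ (_ + _)]rmorphD /= hornerD; congr (_ + _).
rewrite muniZ muniE msuppX big_seq1 mcoeffX eqxx scale1r -!mul_polyC !mulrA -polyCM.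
rewrite [map_poly _ _]rmorphM /= map_polyC map_polyXn hornerM hornerC hornerXn /=.
rewrite mevalZ mevalM mevalC !mevalX big_ord_recr /= mulrA; congr (_ * _ * _).
by apply: eq_bigr => i _; rewrite mnmE.
Qed.

End Muni.

Lemma mpoly_unitE n (p : {mpoly F[n]}) : (p \is a GRing.unit) = (msize p == 1%N).
Proof.
apply/idP/idP => [/andP[/eqP pC u]|/msize_poly1P [c c0 ->]].
  by rewrite pC msizeC -unitfE u.
by rewrite rmorph_unit // unitfE.
Qed.

Lemma prime_productM (R : idomainType) (a b : R) :
  prime_product a -> prime_product b -> prime_product (a * b).
Proof.
move=> pa pb; elim: pa => {a} [u uu|p a pp _ IH]; last first.
  by rewrite -mulrA; apply: PrimeProductMul.
case: pb => {b} [v uv|p a [p0 pu pp] pa]; first by constructor; rewrite unitrM uu.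
rewrite mulrA; apply: PrimeProductMul => //.
have dvE z : rdvd (u * p) z <-> rdvd p z.
  split=> -[c ->]; first by exists (c * u); ring.
  by exists (c * u^-1); rewrite mulrA mulrVK.
split; first by rewrite mulf_eq0 negb_or p0 andbT; apply: contraTneq uu => ->; rewrite unitr0.
  by rewrite unitrM negb_and pu orbT.
by move=> x y; rewrite !dvE; apply: pp.
Qed.

Lemma irred_product n (p : {mpoly F[n]}) :
    (forall q : {mpoly F[n]}, rirred q -> rprime q) -> p != 0 ->
  prime_product p.
Proof.
move=> irp; have [k le_k] := ubnP (msize p); elim: k p le_k => // k IH p le_k p0.
have [up|nup] := boolP (p \is a GRing.unit); first by constructor.
case: (classic (rirred p)) => [/irp pp|nirr].
  by rewrite -[p]mulr1; apply: PrimeProductMul => //; constructor; rewrite unitr1.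
case: (classic (exists a b, [/\ p = a * b, a \isn't a GRing.unit & b \isn't a GRing.unit])).
  move=> [a [b [pab ua ub]]].
  have [a0 b0] : a != 0 /\ b != 0.
    by apply/andP; move: p0; rewrite pab mulf_eq0 negb_or.
  move: le_k; rewrite pab msizeM // => le_k.
  move: ua ub; rewrite !mpoly_unitE => ua ub.
  have := a0; have := b0; rewrite -!msize_poly_eq0 => sa sb.
  set x := msize a in sa ua le_k *; set y := msize b in sb ub le_k *.
  apply: prime_productM; apply: IH => //; rewrite -?/x -?/y; lia.
move=> no; case: nirr; split=> // a b pab.
case: (boolP (a \is a GRing.unit)) => [|ua]; first by left.
case: (boolP (b \is a GRing.unit)) => [|ub]; first by right.
by case: no; exists a, b.
Qed.

Lemma mpoly_irred_prime n (p : {mpoly F[n]}) : rirred p -> rprime p.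
Proof.
elim: n p => [|n IH] p irp.
  have [p0 pu _] := irp; case/negP: pu; rewrite mpoly_unitE.
  by move: p0; rewrite (nvar0_mpolyC p) mpolyC_eq0 msizeC => ->.
apply/rprime_muni/rirred_poly_prime; last exact: rirred_muni.
by move=> a; apply: irred_product.
Qed.

Lemma mpoly_factorial n (p : {mpoly F[n]}) : p != 0 -> prime_product p.
Proof. by apply: irred_product; apply: mpoly_irred_prime. Qed.

Lemma mpoly_eliminant n (p q : {mpoly F[n.+1]}) :
    rprime p -> p^`M(ord_max) != 0 -> ~ rdvd p q ->
  exists a b w, [/\ w != 0 & mwiden w = a * p + b * q].
Proof.
move=> pp dp npq; have [|||a [b [c [c0 cE]]]] := @rprime_eliminant _ (muni p) (muni q).
- exact/rprime_muni.
- exact: size_muni_gt1.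
- by rewrite rdvd_muni.
exists (mmulti a), (mmulti b), c; split=> //.
by apply: muni_inj; rewrite muni_mwiden cE muniD 2!muniM 2!mmultiK.
Qed.

End MpolyRing.

(** * Points on hypersurfaces *)

Section ClosedFieldPoints.
Variable F : closedFieldType.

Definition extend_pt n (x : 'I_n -> F) (z : F) (i : 'I_n.+1) : F :=
  if unlift ord_max i is Some j then x j else z.

Lemma extend_pt_widen n (x : 'I_n -> F) z :
  extend_pt x z \o widen_ord (leqnSn n) =1 x.
Proof.
move=> i /=; rewrite /extend_pt (_ : widen_ord _ _ = lift ord_max i) ?liftK //.
by apply: val_inj; rewrite /= /bump leqNgt ltn_ord.
Qed.

Lemma meval_extend_pt n (p : {mpoly F[n.+1]}) (x : 'I_n -> F) z :
  p.@[extend_pt x z] = (map_poly (meval x) (muni p)).[z].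
Proof.
rewrite meval_muni /extend_pt unlift_none; congr (_.[_]); apply: eq_map_poly => q.
by apply: meval_eq; apply: extend_pt_widen.
Qed.

Lemma mwiden_extend_pt n (p : {mpoly F[n]}) (x : 'I_n -> F) z :
  (mwiden p).@[extend_pt x z] = p.@[x].
Proof. by rewrite meval_extend_pt muni_mwiden map_polyC hornerC. Qed.

Lemma mpoly_nonvanishing n (p : {mpoly F[n]}) : p != 0 -> exists x, p.@[x] != 0.
Proof.
elim: n p => [|n IH] p p0.
  exists (fun _ => 0); move: p0; rewrite (nvar0_mpolyC p) mpolyC_eq0.
  by rewrite mevalC.
have /IH [x xn0] : lead_coef (muni p) != 0 by rewrite lead_coef_eq0 muni_eq0.
have : map_poly (meval x) (muni p) != 0.
  by rewrite -size_poly_gt0 size_map_poly_id0 // size_poly_gt0 muni_eq0.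
by move/closed_nonrootP => [z zr]; exists (extend_pt x z); rewrite meval_extend_pt.
Qed.

(** Generic values of the other coordinates are completed to a zero of [p] by solving for the last
    one; if [h] vanished there too, so would the eliminant [w]. *)
Lemma rprime_nonvanishing n (p h : {mpoly F[n.+2]}) :
    rprime p -> p^`M(ord_max) != 0 -> ~ rdvd p h ->
  exists x, [/\ nonzero_pt x, p.@[x] = 0 & h.@[x] != 0].
Proof.
move=> pp dp nph; have [a [b [w [w0 wE]]]] := mpoly_eliminant pp dp nph.
have [p0 _ _] := pp.
(* [w] separates [h] from [p], the leading coefficient keeps the degree in the last variable under
   specialization, and ['X_ord0] makes the point nonzero. *)
have : w * lead_coef (muni p) * 'X_ord0 != 0.
  rewrite !mulf_eq0 !negb_or w0 lead_coef_eq0 muni_eq0 p0 /=.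
  by rewrite -msize_poly_eq0 msizeX.
move/mpoly_nonvanishing => [x]; rewrite !mevalM mevalXU !mulf_eq0 !negb_or.
case/andP=> /andP[wx lx] x0.
have : size (map_poly (meval x) (muni p)) != 1%N.
  by rewrite size_map_poly_id0 // gtn_eqF // size_muni_gt1.
move/closed_rootP => [z /rootP zr].
have pz : p.@[extend_pt x z] = 0 by rewrite meval_extend_pt.
exists (extend_pt x z); split=> //.
- exists (widen_ord (leqnSn n.+1) ord0).
  by have /= -> := extend_pt_widen x z ord0.
- apply: contraNneq wx => h0; rewrite -(mwiden_extend_pt w x z) wE.
  by rewrite mevalD 2!mevalM h0 pz 2!mulr0 addr0.
Qed.

End ClosedFieldPoints.

(** * Nullstellensatz in the affine and the projective plane *)

Definition in_ideal (R : comNzRingType) (I : finType) (g : I -> R) (p : R) :=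
  exists a : I -> R, p = \sum_i a i * g i.

Section Ideal.
Variables (R : comNzRingType) (I : finType) (g : I -> R).

Lemma in_idealD p q : in_ideal g p -> in_ideal g q -> in_ideal g (p + q).
Proof.
move=> [a ->] [b ->]; exists (fun i => a i + b i); rewrite -big_split /=.
by apply: eq_bigr => i _; rewrite mulrDl.
Qed.

Lemma in_ideal_mull p q : in_ideal g q -> in_ideal g (p * q).
Proof.
move=> [a ->]; exists (fun i => p * a i); rewrite mulr_sumr.
by apply: eq_bigr => i _; rewrite mulrA.
Qed.

Lemma in_ideal_gen i : in_ideal g (g i).
Proof.
exists (fun j => (j == i)%:R); rewrite (bigD1 i) //= eqxx mul1r big1 ?addr0 //.
by move=> j /negPf->; rewrite mul0r.
Qed.

End Ideal.

Section AffineNullstellensatz.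
Variable F : closedFieldType.

Lemma line_nullstellensatz (I : finType) (g : I -> {poly F}) :
  (forall x, exists i, (g i).[x] != 0) -> in_ideal g 1.
Proof.
move=> ncz; have [|||w [Iw nzw wmin]] := @min_size_generator _ (in_ideal g).
- exact: in_idealD.
- by move=> a b; apply: in_ideal_mull.
- have [i gi] := ncz 0; exists (g i); first exact: in_ideal_gen.
  by apply: contraNneq gi => ->; rewrite horner0.
have [/eqP sw|sw] := boolP (size w == 1%N).
  have wC : w = (w`_0)%:P by apply: size1_polyC; rewrite sw.
  have w0 : w`_0 != 0 by rewrite -polyC_eq0 -wC.
  by rewrite -polyC1 -(mulVf w0) polyCM -wC; apply: in_ideal_mull.
case/closed_rootP: sw => z /rootP wz; have [i giz] := ncz z.
have [k [q /(congr1 (horner^~ z))]] := wmin _ (in_ideal_gen g i).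
rewrite hornerZ hornerM wz mulr0 => /eqP.
by rewrite mulf_eq0 (negPf giz) orbF expf_eq0 lead_coef_eq0 (negPf nzw) andbF.
Qed.

Definition eval2 (x y : F) (p : {poly {poly F}}) : F :=
  (map_poly (horner_eval x) p).[y].

(** The ideal contains a nonzero polynomial [w] in the first coordinate alone. Each ['X - x] is
    invertible modulo the ideal, by the case of a line applied to the fibre over [x]. Hence [w], a
    product of such factors and a scalar, is both invertible and zero modulo the ideal. *)
Lemma plane_nullstellensatz (I : finType) (g : I -> {poly {poly F}}) :
  (forall x y, exists i, eval2 x y (g i) != 0) -> in_ideal g 1.
Proof.
move=> ncz; have [w w0 Iw] : exists2 w, w != 0 & in_ideal g w%:P.
  have [|||w [Iw nzw wmin]] := @min_size_generator _ (in_ideal g).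
  - exact: in_idealD.
  - by move=> a b; apply: in_ideal_mull.
  - have [i gi] := ncz 0 0; exists (g i); first exact: in_ideal_gen.
    by apply: contraNneq gi => ->; rewrite /eval2 map_poly0 horner0.
  have [sw|sw] := leqP (size w) 1.
    have wC := size1_polyC sw; exists w`_0; last by rewrite -wC.
    by apply: contraNneq nzw => e; rewrite wC e.
  (* A nonconstant [w] has a root above any [x] that keeps its leading coefficient, and this root
     would be a common zero. *)
  have /closed_nonrootP [x lx] : lead_coef w != 0 by rewrite lead_coef_eq0.
  have : size (map_poly (horner_eval x) w) != 1%N.
    by rewrite size_map_poly_id0 ?gtn_eqF.
  case/closed_rootP=> y /rootP wxy; have [i gi] := ncz x y.
  have [k [q /(congr1 (eval2 x y))]] := wmin _ (in_ideal_gen g i).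
  rewrite -mul_polyC /eval2 !rmorphM /= !hornerM wxy mulr0 map_polyC hornerC /=.
  move/eqP; rewrite mulf_eq0 [X in _ || X](negPf gi) orbF /horner_eval.
  by rewrite horner_exp expf_eq0 [X in _ && X](negPf lx) andbF.
have fiber x : exists v, in_ideal g (1 - v * ('X - x%:P)%:P).
  have [|a aE] := @line_nullstellensatz I (fun i => map_poly (horner_eval x) (g i)).
    exact: ncz.
  (* [p] vanishes on the fibre over [x], so each of its coefficients is a multiple of ['X - x]. *)
  pose p := 1 - \sum_i map_poly polyC (a i) * g i.
  have [|v vE] := @rdvd_polyC _ ('X - x%:P) p.
    move=> k; have : root p`_k x.
      have : (map_poly (horner_eval x) p)`_k = 0.
        rewrite rmorphB rmorph1 rmorph_sum /= [X in X - _]aE -sumrB big1 ?coef0 // => i _.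
        rewrite rmorphM /= -map_poly_comp map_poly_id ?subrr // => c _ /=.
        by rewrite /horner_eval hornerC.
      by rewrite coef_map => /rootP.
    by case/factor_theorem => q qE; exists q.
  exists v; exists (fun i => map_poly polyC (a i)).
  by rewrite -vE /p; ring.
have prods (s : seq F) : exists v, in_ideal g (1 - v * (\prod_(x <- s) ('X - x%:P))%:P).
  elim: s => [|x s [v Iv]].
    by exists 1; rewrite big_nil mulr1 subrr; exists (fun=> 0); rewrite big1 // => i; rewrite mul0r.
  have [u Iu] := fiber x; exists (u * v); rewrite big_cons polyCM.
  set A := _%:P in Iu *; set B := _%:P in Iv *.
  have -> : 1 - u * v * (A * B) = (1 - u * A) + (u * A) * (1 - v * B) by ring.
  by apply: in_idealD => //; apply: in_ideal_mull.
have [s wE] := closed_field_poly_normal w.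
have [v Iv] := prods s; set B := _%:P in Iv.
have lw : lead_coef w != 0 by rewrite lead_coef_eq0.
have BE : B = (lead_coef w)^-1%:P%:P * w%:P.
  rewrite -polyCM; congr polyC.
  by rewrite mul_polyC [X in _ = _ *: X]wE scalerA mulVf // scale1r.
have -> : 1 = (1 - v * B) + (v * (lead_coef w)^-1%:P%:P) * w%:P.
  by rewrite -mulrA -BE subrK.
by apply: in_idealD => //; apply: in_ideal_mull.
Qed.

End AffineNullstellensatz.

(** * Forms *)

Section Forms.
Variables (F : closedFieldType) (n : nat).
Implicit Types p q a b : {mpoly F[n]}.

Lemma mpoly_ring_ind (P : {mpoly F[n]} -> Prop) :
    (forall c, P c%:MP) -> (forall i, P 'X_i) ->
    (forall p q, P p -> P q -> P (p + q)) ->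
    (forall p q, P p -> P q -> P (p * q)) ->
  forall p, P p.
Proof.
move=> PC PX PD PM p; rewrite [p]mpolyE.
elim/big_ind: _ => [||m _]; first by rewrite -mpolyC0.
  exact: PD.
rewrite -mul_mpolyC; apply: (PM) => //; rewrite mpolyXE_id.
elim/big_ind: _ => [||i _]; first by rewrite -mpolyC1.
  exact: PM.
by elim: (m i) => [|k IH]; rewrite ?expr0 -?mpolyC1 // exprS; apply: PM.
Qed.

Lemma meval_scale p d t (x : 'I_n -> F) :
  p \is d.-homog -> p.@[fun i => t * x i] = t ^+ d * p.@[x].
Proof.
move=> /dhomogP hp; rewrite !mevalE mulr_sumr big_seq [RHS]big_seq.
apply: eq_bigr => m /hp /= <-; rewrite mulrCA; congr (_ * _).
under eq_bigr do rewrite exprMn.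
by rewrite big_split /= mdegE prodrXr.
Qed.

Lemma euler_form p d : p \is d.-homog ->
  \sum_i 'X_i * p^`M(i) = d%:R *: p.
Proof.
move=> /dhomogP hp; rewrite {2}[p]mpolyE scaler_sumr.
under eq_bigr do rewrite {1}[p]mpolyE raddf_sum mulr_sumr /=.
rewrite exchange_big /= big_seq [RHS]big_seq; apply: eq_bigr => m /hp /= <-.
under eq_bigr do rewrite mderivZ mderivX scalerA -scalerAr.
rewrite scalerA mdegE natr_sum mulr_suml scaler_suml; apply: eq_bigr => i _.
have [->|mi] := eqVneq (m i) 0%N; first by rewrite mulr0 mul0r !scale0r.
rewrite mulrC -mpolyXD addmC submK // lep1mP //.
Qed.

Lemma dhomog_mderiv p d i : p \is d.-homog -> p^`M(i) \is d.-1.-homog.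
Proof.
move=> /dhomogP hp; apply/dhomogP => m; rewrite mcoeff_msupp mcoeff_deriv => nz.
have /hp : (m + U_(i))%MM \in msupp p.
  by rewrite mcoeff_msupp; apply: contraNneq nz => ->; rewrite mul0rn.
by rewrite /= mdegD mdeg1 => <-; rewrite addn1.
Qed.

Lemma dhomog_const p : p \is 0.-homog -> p = (p@_0)%:MP.
Proof.
move=> /dhomogP hp; apply: msize1_polyC; rewrite msizeE.
by apply/bigmax_leqP_seq => m /hp /= ->.
Qed.

Lemma dhomogXU i : ('X_i : {mpoly F[n]}) \is 1.-homog.
Proof. by rewrite dhomogX /= mdeg1. Qed.

Lemma dhomogXUn i k : ('X_i ^+ k : {mpoly F[n]}) \is k.-homog.
Proof. by have := dhomogMn k (dhomogXU i); rewrite mul1n. Qed.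

Lemma dhomog_prodX k (lq : n.-tuple {mpoly F[k]}) e (m : 'X_{1..n}) :
    (forall i, tnth lq i \is e.-homog) ->
  \prod_(i < n) tnth lq i ^+ m i \is (mdeg m * e).-homog.
Proof.
move=> hq; rewrite mdegE big_distrl /=.
elim/big_ind2: _ => [|x1 p1 x2 p2 h1 h2|i _]; first exact: dhomog1.
  exact: dhomogM.
by rewrite mulnC; apply: dhomogMn.
Qed.

Lemma dhomog_comp k p (lq : n.-tuple {mpoly F[k]}) d e :
    p \is d.-homog -> (forall i, tnth lq i \is e.-homog) ->
  p \mPo lq \is (d * e).-homog.
Proof.
move=> /dhomogP hp hq; rewrite comp_mpolyEX big_seq.
apply: rpred_sum => m /hp /= <-; apply: rpredZ; rewrite comp_mpolyX.
exact: dhomog_prodX.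
Qed.

(* [p |-> p(t x)], which separates the homogeneous components of [p]. *)
Definition grading : {mpoly F[n]} -> {poly {mpoly F[n]}} :=
  mmap (polyC \o @mpolyC n F) (fun i => 'X_i *: 'X).

Lemma gradingX m : grading 'X_[m] = 'X_[m] *: 'X^(mdeg m).
Proof.
rewrite /grading mmapX /mmap1; under eq_bigr do rewrite exprZn.
by rewrite scaler_prod -mpolyXE_id mdegE prodrXr.
Qed.

Lemma gradingD : {morph grading : p q / p + q}.
Proof. by move=> p q; apply: mmapD. Qed.

Lemma gradingM : {morph grading : p q / p * q}.
Proof. by move=> p q; apply: rmorphM. Qed.

Lemma gradingZ c p : grading (c *: p) = c%:MP *: grading p.
Proof. by rewrite /grading mmapZ mul_polyC. Qed.

Lemma coef_grading p k : (grading p)`_k = pihomog mdeg k p.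
Proof.
elim/mpolyind: p => [|c m p _ _ IH].
  by rewrite /grading mmap0 coef0 pihomog0.
rewrite gradingD coefD pihomogD; apply: (f_equal2 +%R) IH.
rewrite gradingZ gradingX 2!coefZ coefXn [RHS]linearZ /= pihomogX eq_sym.
by case: eqP => _; rewrite ?mulr1n ?mulr0n ?mulr1 ?mulr0 ?scaler0 // mul_mpolyC.
Qed.

Lemma grading_homog p d : p \is d.-homog -> grading p = p *: 'X^d.
Proof.
move=> hp; apply/polyP => k; rewrite coef_grading coefZ coefXn.
have [->|ne] := eqVneq k d; first by rewrite pihomog_dE // mulr1n mulr1.
by rewrite mulr0n mulr0 (pihomog_ne0 _ hp) // eq_sym.
Qed.

Lemma homog_grading p q d : grading p = q *: 'X^d -> p \is d.-homog.
Proof.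
move=> e; have := pihomog_partitionE (mf := mdeg) (leqnn (msize p)).
move=> ->; apply: rpred_sum => k _; rewrite -coef_grading e coefZ coefXn.
have [ekd|_] := eqVneq (k : nat) d; last by rewrite mulr0n mulr0 rpred0.
rewrite mulr1n mulr1.
have -> : q = pihomog mdeg d p by rewrite -coef_grading e coefZ coefXn eqxx mulr1n mulr1.
exact: pihomogP.
Qed.

Lemma grading_neq0 p : p != 0 -> grading p != 0.
Proof.
apply: contraNneq => e; rewrite (pihomog_partitionE (mf := mdeg) (leqnn (msize p))).
by rewrite big1 // => k _; rewrite -coef_grading e coef0.
Qed.

(* Compare the orders of vanishing at [t = 0] and the degrees in [t] on both
   sides of [grading a * grading b = p t^d]. *)
Lemma homog_factor p a b d :
  p != 0 -> p \is d.-homog -> p = a * b -> exists k, a \is k.-homog.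
Proof.
move=> p0 hp pab.
have [a0 b0] : a != 0 /\ b != 0.
  by apply/andP; move: p0; rewrite pab mulf_eq0 negb_or.
have := grading_homog hp; rewrite pab gradingM -pab.
have [i [qa qa0 aE]] := multiplicity_XsubC (grading a) 0.
have [j [qb qb0 bE]] := multiplicity_XsubC (grading b) 0.
rewrite grading_neq0 //= in qa0; rewrite grading_neq0 //= in qb0.
rewrite subr0 in aE bE; rewrite aE bE mulrACA -exprD -mul_polyC => e.
have [lt|lt|eqd] := ltngtP (i + j)%N d.
- have /eqP : qa * qb = p%:P * 'X^(d - (i + j)).
    apply: (@mulIf _ 'X^(i + j)); first by rewrite -size_poly_eq0 size_polyXn.
    by rewrite e -mulrA -exprD subnK // ltnW.
  move/eqP/(congr1 (horner^~ 0)); rewrite !hornerM hornerXn expr0n.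
  rewrite (_ : (d - (i + j) == 0)%N = false); last by lia.
  by rewrite mulr0n mulr0 => /eqP; rewrite mulf_eq0 => /orP[e0|e0]; [case/negP: qa0|case/negP: qb0].
- have : p%:P = qa * qb * 'X^(i + j - d).
    apply: (@mulIf _ 'X^d); first by rewrite -size_poly_eq0 size_polyXn.
    by rewrite -e -[RHS]mulrA -exprD subnK // ltnW.
  move/(congr1 (horner^~ 0)); rewrite !hornerM hornerXn expr0n hornerC.
  rewrite (_ : (i + j - d == 0)%N = false); last by lia.
  by rewrite mulr0n mulr0 => e0; rewrite e0 eqxx in p0.
- have qab : qa * qb = p%:P.
    apply: (@mulIf _ 'X^d); first by rewrite -size_poly_eq0 size_polyXn.
    by rewrite -{1}eqd.
  have qan0 : qa != 0 by apply: contraNneq qa0 => ->; rewrite root0.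
  have qbn0 : qb != 0 by apply: contraNneq qb0 => ->; rewrite root0.
  have sqa : (size qa <= 1)%N.
    have := congr1 (fun q : {poly _} => size q) qab.
    rewrite size_polyC p0 size_mul //.
    move: qan0 qbn0; rewrite -2!size_poly_gt0.
    by move: (size qa) (size qb) => x y; lia.
  exists i; apply: (@homog_grading _ qa`_0).
  by rewrite aE [in LHS](size1_polyC sqa) mul_polyC.
Qed.

Lemma horner_mmap p (h : 'I_n -> {poly F}) s :
  (mmap polyC h p).[s] = p.@[fun i => (h i).[s]].
Proof.
elim/mpoly_ring_ind: p => [c|i|p q IHp IHq|p q IHp IHq].
- by rewrite mmapC hornerC mevalC.
- by rewrite mmapX mmap1U mevalXU.
- by rewrite mmapD hornerD IHp IHq mevalD.
- by rewrite rmorphM hornerM mevalM; apply: (f_equal2 *%R).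
Qed.

(** For t = 1 either the restriction [q] has a root or it is a constant. In the second case
    homogeneity turns the restriction [r] for s = 1 into that constant times t^d, which vanishes at
    t = 0: the point [u] itself is a zero. *)
Lemma homog_line_zero p d (u v : 'I_n -> F) : p \is d.-homog -> (0 < d)%N ->
  exists s t, (s != 0) || (t != 0) /\ p.@[fun i => s * u i + t * v i] = 0.
Proof.
move=> hp d0; pose q := mmap polyC (fun i => u i *: 'X + (v i)%:P) p.
have qE s : q.[s] = p.@[fun i => s * u i + v i].
  by rewrite horner_mmap; apply: meval_eq => i; rewrite !hornerE mulrC.
have [/eqP sq|] := boolP (size q == 1%N); last first.
  case/closed_rootP=> s /rootP qs; exists s, 1; rewrite oner_eq0 orbT -qs qE.
  by split=> //; apply: meval_eq => i; rewrite mul1r.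
have qC s : q.[s] = q`_0 by rewrite {1}(@size1_polyC _ q) ?sq // hornerC.
pose r := mmap polyC (fun i => (u i)%:P + v i *: 'X) p.
have rE t : r.[t] = p.@[fun i => u i + t * v i].
  by rewrite horner_mmap; apply: meval_eq => i; rewrite !hornerE [v i * t]mulrC.
have rX : (r - q`_0 *: 'X^d) * 'X = 0.
  apply/eqP; apply: contraT => /closed_nonrootP [t /negP []]; apply/rootP.
  rewrite hornerM hornerX; have [->|t0] := eqVneq t 0; first by rewrite mulr0.
  rewrite hornerD hornerN hornerZ hornerXn rE.
  rewrite (@meval_eq _ _ _ (fun i => t * (t^-1 * u i + v i))); last first.
    by move=> i; rewrite mulrDr mulrA divff // mul1r.
  by rewrite (meval_scale _ _ hp) -qE qC [t ^+ d * _]mulrC subrr mul0r.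
have /eqP : r = q`_0 *: 'X^d.
  by apply/eqP; move/eqP: rX; rewrite mulf_eq0 polyX_eq0 orbF subr_eq0.
move/eqP/(congr1 (horner^~ 0)); rewrite rE hornerZ hornerXn expr0n eqn0Ngt d0.
rewrite mulr0n mulr0 => p0; exists 1, 0; rewrite oner_eq0; split=> //.
by rewrite -[RHS]p0; apply: meval_eq => i; rewrite mul1r.
Qed.

End Forms.

Section ProjectiveNullstellensatz.
Variable F : closedFieldType.
Implicit Types p q : {mpoly F[3]}.

Section Dehomogenization.
Variables k i j : 'I_3.
Hypothesis kijP : forall l, [|| l == k, l == i | l == j].
Hypotheses (ik : i != k) (jk : j != k) (ji : j != i).

Definition chart_pt (a b : F) (l : 'I_3) : F :=
  if l == k then 1 else if l == i then a else b.

Definition dehomog : {mpoly F[3]} -> {poly {poly F}} :=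
  mmap (polyC \o polyC) (fun l => if l == k then 1 else if l == i then 'X%:P else 'X).

Lemma dehomogD : {morph dehomog : p q / p + q}.
Proof. by move=> p q; apply: mmapD. Qed.

Lemma dehomogM : {morph dehomog : p q / p * q}.
Proof. by move=> p q; apply: rmorphM. Qed.

Lemma dehomogB : {morph dehomog : p q / p - q}.
Proof. by move=> p q; apply: mmapB. Qed.

Lemma dehomog_sum (I : finType) (f : I -> {mpoly F[3]}) :
  dehomog (\sum_l f l) = \sum_l dehomog (f l).
Proof. exact: raddf_sum. Qed.

Lemma dehomogC c : dehomog c%:MP = c%:P%:P.
Proof. by rewrite /dehomog mmapC. Qed.

Lemma dehomogX l :
  dehomog 'X_l = if l == k then 1 else if l == i then 'X%:P else 'X.
Proof. by rewrite /dehomog mmapX mmap1U. Qed.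

Lemma dehomogXk N : dehomog ('X_k ^+ N) = 1.
Proof.
elim: N => [|N IH]; first by rewrite expr0 -mpolyC1 dehomogC.
by rewrite exprS dehomogM IH dehomogX eqxx mulr1.
Qed.

Lemma eval2_dehomog p a b : eval2 a b (dehomog p) = p.@[chart_pt a b].
Proof.
elim/mpoly_ring_ind: p => [c|l|p q IHp IHq|p q IHp IHq].
- by rewrite dehomogC /eval2 map_polyC hornerC mevalC /= /horner_eval hornerC.
- rewrite dehomogX mevalXU /chart_pt /eval2; case: ifP => _.
    by rewrite rmorph1 hornerC.
  case: ifP => _; last by rewrite map_polyX hornerX.
  by rewrite map_polyC hornerC /= /horner_eval hornerX.
- by rewrite dehomogD /eval2 rmorphD hornerD mevalD; apply: (f_equal2 +%R).
- by rewrite dehomogM /eval2 rmorphM hornerM mevalM; apply: (f_equal2 *%R).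
Qed.

(** Multiplication by ['X_k] kills the points outside the chart, so the vanishing can be tested
    inside it. *)
Lemma dehomog_eq0 p N : p \is N.-homog -> dehomog p = 0 -> p = 0.
Proof.
move=> hp p0; suff /eqP : p * 'X_k = 0.
  by rewrite mulf_eq0 -[X in _ || X]msize_poly_eq0 msizeX orbF => /eqP.
apply/eqP; apply: contraT => /mpoly_nonvanishing [x].
rewrite mevalM mevalXU mulf_eq0 negb_or => /andP[px xk]; case/negP: px.
have -> : p.@[x] = x k ^+ N * p.@[chart_pt (x i / x k) (x j / x k)].
  rewrite -meval_scale //; apply: meval_eq => l; rewrite /chart_pt.
  case/or3P: (kijP l) => /eqP->; rewrite ?eqxx ?mulr1 // ?(negPf ik) ?(negPf jk).
    by rewrite mulrC divfK.
  by rewrite (negPf ji) mulrC divfK.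
by rewrite -eval2_dehomog p0 /eval2 map_poly0 horner0 mulr0.
Qed.

(** All large degrees are provided at once, so that several polynomials can be lifted to prescribed
    degrees. Powers of ['X_k], which dehomogenize to 1, fill up the degree. *)
Lemma dehomog_lift (a : {poly {poly F}}) :
  exists N0, forall N, (N0 <= N)%N -> exists2 A, A \is N.-homog & dehomog A = a.
Proof.
have step (b : {poly {poly F}}) l N0 A0 :
    (forall N, (N0 <= N)%N -> exists2 A, A \is N.-homog & dehomog A = b) ->
    (forall N, (A0 <= N)%N -> exists2 A, A \is N.-homog & dehomog A = l) ->
    forall m, forall N, ((maxn N0 A0).+1 <= N)%N ->
    exists2 A, A \is N.-homog & dehomog A = b * dehomog 'X_m + l.
  move=> hb hl m [//|N] lN.
  have [|A hA <-] := hb N; first by lia.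
  have [|B hB <-] := hl N.+1; first by lia.
  exists (A * 'X_m + B); last by rewrite dehomogD dehomogM.
  by rewrite rpredD //; have := dhomogM hA (dhomogXU F m); rewrite addn1.
have const (c : F) N : exists2 A, A \is N.-homog & dehomog A = c%:P%:P.
  exists (c *: 'X_k ^+ N); first by rewrite rpredZ // dhomogXUn.
  by rewrite -mul_mpolyC dehomogM dehomogC dehomogXk mulr1.
elim/poly_ind: a => [|a c [N0 ha]].
  by exists 0%N => N _; have [A hA eA] := const 0 N; exists A; rewrite // eA polyC0.
have [M0 hc] : exists N0, forall N, (N0 <= N)%N ->
    exists2 A, A \is N.-homog & dehomog A = c%:P.
  elim/poly_ind: c => [|c d [M0 hc]].
    by exists 0%N => N _; have [A hA eA] := const 0 N; exists A; rewrite // eA polyC0.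
  exists (maxn M0 0).+1; rewrite polyCD polyCM.
  have -> : 'X%:P = dehomog 'X_i by rewrite dehomogX (negPf ik) eqxx.
  by apply: step => // N _; apply: const.
exists (maxn N0 M0).+1.
have -> : 'X = dehomog 'X_j by rewrite dehomogX (negPf jk) (negPf ji).
exact: step.
Qed.

Lemma power_in_ideal (I : finType) (G : I -> {mpoly F[3]}) (D : I -> nat) :
    (forall l, G l \is (D l).-homog) ->
    (forall x, x k != 0 -> exists l, (G l).@[x] != 0) ->
  exists N, (forall l, D l <= N)%N /\
    exists2 A : I -> {mpoly F[3]}, forall l, A l \is (N - D l).-homog
      & 'X_k ^+ N = \sum_l A l * G l.
Proof.
move=> hG ncz; have [|a aE] := @plane_nullstellensatz _ I (dehomog \o G).
  move=> a b; have [|l hl] := ncz (chart_pt a b).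
    by rewrite /chart_pt eqxx oner_eq0.
  by exists l; rewrite /= eval2_dehomog.
have /fin_all_exists [M hM] l := dehomog_lift (a l).
pose N := (\max_l (D l + M l))%N.
have hN l : (D l + M l <= N)%N by rewrite /N (bigmax_sup l).
exists N; split; first by move=> l; have := hN l; lia.
have /fin_all_exists2 [A hA AE] l : exists2 A, A \is (N - D l).-homog & dehomog A = a l.
  by apply: hM; have := hN l; lia.
exists A => //; apply/eqP; rewrite -subr_eq0; apply/eqP.
have hsum : \sum_l A l * G l \is N.-homog.
  apply: rpred_sum => l _; have := dhomogM (hA l) (hG l).
  by rewrite subnK //; have := hN l; lia.
apply: (@dehomog_eq0 _ N); first by rewrite rpredB // dhomogXUn.
rewrite dehomogB dehomogXk dehomog_sum [X in X - _]aE -sumrB big1 // => l _.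
by rewrite dehomogM AE subrr.
Qed.

End Dehomogenization.

(** Each chart puts a power ['X_k ^+ N k] into the ideal, and a monomial whose degree is the sum of
    the [N k] is divisible by one of these powers. The degrees of the coefficients are recorded
    because the applications are linear algebra in one fixed degree. *)
Lemma projective_nullstellensatz (I : finType) (G : I -> {mpoly F[3]}) (D : I -> nat) :
    (forall l, G l \is (D l).-homog) ->
    (forall x, nonzero_pt x -> exists l, (G l).@[x] != 0) ->
  exists L, (forall l, D l <= L)%N /\
    forall M, M \is L.-homog ->
    exists2 A : I -> {mpoly F[3]}, forall l, A l \is (L - D l).-homog
      & M = \sum_l A l * G l.
Proof.
move=> hG ncz.
have powers (k : 'I_3) : exists N, (forall l, D l <= N)%N /\
    exists2 A : I -> {mpoly F[3]}, forall l, A l \is (N - D l).-homog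
      & 'X_k ^+ N = \sum_l A l * G l.
  have ncz' x : x k != 0 -> exists l, (G l).@[x] != 0 by move=> xk; apply: ncz; exists k.
  (* Addition in ['I_3] is modulo 3, so [k], [k + 1], [k + 2] are the three variables. *)
  apply: (@power_in_ideal k (k + 1) (k + 2%:R)) => // {ncz'}; try by case: k => [[|[|[|]]]].
  by move=> l; case: k => [[|[|[|//]]]] ?; case: l => [[|[|[|//]]]].
have /fin_all_exists [N hN] := powers.
have DN l k : (D l <= N k)%N by have [] := hN k.
exists (\sum_k N k)%N; split=> [l|M hM].
  by rewrite (bigD1 ord0) //= (leq_trans (DN l ord0)) // leq_addr.
set L := (\sum_k N k)%N in hM *.
pose P M := exists2 A : I -> {mpoly F[3]}, forall l, A l \is (L - D l).-homog
      & M = \sum_l A l * G l.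
rewrite -/(P M) [M]mpolyE big_seq; elim/big_ind: _ => [|p q|m mM].
- by exists (fun=> 0) => [l|]; rewrite ?rpred0 // big1 // => l _; rewrite mul0r.
- move=> [A hA ->] [B hB ->]; exists (fun l => A l + B l) => [l|].
    by rewrite rpredD.
  by rewrite -big_split; apply: eq_bigr => l _; rewrite mulrDl.
have /= mL := dhomog_mf hM mM.
have [k hk] : exists k, (N k <= m k)%N.
  apply: NNPP => no; suff : (mdeg m < L)%N by rewrite mL ltnn.
  rewrite mdegE /L; have lt l : (m l < N l)%N by rewrite ltnNge; apply/negP => h; apply: no; exists l.
  rewrite !big_ord_recl !big_ord0; have := lt ord0.
  have := lt (lift ord0 ord0); have := lt (lift ord0 (lift ord0 ord0)); lia.
have [_ [A hA AE]] := hN k.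
pose r := (m - U_(k) *+ N k)%MM.
have mE : m = (U_(k) *+ N k + r)%MM.
  rewrite addmC submK //; apply/mnm_lepP => l; rewrite mulmnE mnm1E.
  by case: eqP => [<-|_]; rewrite ?mul1n ?mul0n.
exists (fun l => M@_m *: ('X_[r] * A l)) => [l|].
  rewrite rpredZ //.
  have -> : (L - D l = mdeg r + (N k - D l))%N.
    rewrite -mL {1}mE mdegD mdegMn mdeg1; have := DN l k; lia.
  by rewrite dhomogM // dhomogX.
rewrite {2}mE mpolyXD -mpolyXn AE mulrC mulr_sumr scaler_sumr.
by apply: eq_bigr => l _; rewrite -scalerAl mulrA.
Qed.

End ProjectiveNullstellensatz.

(** * Regular functions on plane curves *)

Section MonomialBasis.
Variables (F : closedFieldType) (n d : nat).

Definition monos : finType := {m : 'X_{1..n < d.+1} | mdeg m == d}.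

Definition mono (a : 'I_#|monos|) : 'X_{1..n} := val (val (enum_val a)).

Lemma mdeg_mono a : mdeg (mono a) = d.
Proof. exact/eqP/(valP (enum_val a)). Qed.

Lemma mono_onto m : mdeg m = d -> exists a, mono a = m.
Proof.
move=> md; have ltm : (mdeg m < d.+1)%N by rewrite md.
have md' : mdeg (BMultinom ltm) == d by rewrite /= md.
by exists (enum_rank (Sub (BMultinom ltm) md' : monos)); rewrite /mono enum_rankK.
Qed.

Lemma mono_inj : injective mono.
Proof. by move=> a b /val_inj /val_inj /enum_val_inj. Qed.

Lemma form_expand (p : {mpoly F[n]}) :
  p \is d.-homog -> p = \sum_a p@_(mono a) *: 'X_[mono a].
Proof.
move=> hp; apply/mpolyP=> m; rewrite raddf_sum /=.
have [md|nmd] := eqVneq (mdeg m) d; last first.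
  rewrite (dhomog_nemf_coeff hp nmd) big1 // => a _.
  rewrite mcoeffZ mcoeffX (_ : (_ == _) = false) ?mulr0 //.
  by apply: contraNF nmd => /eqP<-; rewrite mdeg_mono.
have [a am] := mono_onto md; rewrite (bigD1 a) //= mcoeffZ mcoeffX am eqxx mulr1.
rewrite big1 ?addr0 // => b ba; rewrite mcoeffZ mcoeffX -am (inj_eq mono_inj).
by rewrite (negPf ba) mulr0.
Qed.

End MonomialBasis.

Section Pencils.
Variable F : closedFieldType.

(** The homogenized characteristic polynomial; [s] lists the eigenvalues of [c]. *)
Lemma det_pencil r (c : 'M[F]_r) :
  exists s : seq F, forall a b, \det (a%:M - b *: c) = \prod_(l <- s) (a - l * b).
Proof.
have [s sE] := closed_field_poly_normal (char_poly c); exists s => a b.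
rewrite (monicP (char_poly_monic c)) scale1r in sE.
have size_s : size s = r.
  by have := size_char_poly c; rewrite sE size_prod_XsubC => -[].
have horn x : \det (x%:M - c) = \prod_(l <- s) (x - l).
  have -> : x%:M - c = map_mx (horner_eval x) (char_poly_mx c).
    apply/matrixP=> i j; rewrite !mxE /horner_eval hornerD hornerN hornerC.
    by rewrite hornerMn hornerX.
  rewrite det_map_mx /= -/(char_poly c) sE /horner_eval horner_prod.
  by apply: eq_bigr => l _; rewrite hornerXsubC.
have [->|b0] := eqVneq b 0.
  rewrite scale0r subr0 det_scalar -size_s.
  under eq_bigr do rewrite mulr0 subr0.
  by rewrite big_const_seq count_predT iter_mulr_1.
have -> : a%:M - b *: c = b *: ((a / b)%:M - c).
  by rewrite scalerBr scale_scalar_mx mulrC divfK.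
rewrite detZ horn -size_s; elim: (s) => [|l t IH]; first by rewrite !big_nil mulr1.
rewrite !big_cons -IH /= exprS mulrACA; congr (_ * _).
by field.
Qed.

Lemma mpoly_eq_eval n (p q : {mpoly F[n]}) : (forall x, p.@[x] = q.@[x]) -> p = q.
Proof.
move=> e; apply/eqP; rewrite -subr_eq0; apply: contraT => /mpoly_nonvanishing [x].
by rewrite mevalB e subrr eqxx.
Qed.

(** [N] and [G] are polynomials, but [c] has constant entries, so the [l] are scalars. This is what
    makes a regular function constant. *)
Lemma det_mpoly_pencil n r (c : 'M[F]_r) :
  exists s : seq F, forall N G : {mpoly F[n]},
    \det (N%:M - G *: map_mx (@mpolyC n F) c) = \prod_(l <- s) (N - l *: G).
Proof.
have [s sE] := det_pencil c; exists s => N G; apply: mpoly_eq_eval => x.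
rewrite rmorph_prod /=; under [RHS]eq_bigr do rewrite mevalB mevalZ.
rewrite -sE -det_map_mx; congr (\det _); apply/matrixP=> i j.
by rewrite !mxE /= mevalB mevalM mevalC mevalMn.
Qed.

End Pencils.

Lemma sum_option (V : nmodType) (I : finType) (f : option I -> V) :
  \sum_o f o = f None + \sum_i f (Some i).
Proof.
rewrite (bigD1 None) //=; congr (_ + _); rewrite (reindex_omap Some id) /=.
  by apply: eq_bigl => i; rewrite eqxx.
by case.
Qed.

Section PlaneCurves.
Variable F : closedFieldType.
Notation S := {mpoly F[3]}.

Lemma form_nonunit (p : S) k :
  p != 0 -> p \isn't a GRing.unit -> p \is k.-homog -> (0 < k)%N.
Proof.
move=> p0 pu hp; rewrite lt0n; apply: contraNneq pu => k0; rewrite k0 in hp.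
by rewrite (dhomog_const hp) in p0 *; rewrite rmorph_unit // unitfE -(mpolyC_eq0 3).
Qed.

Lemma rprime_form_degree (p : S) m : rprime p -> p \is m.-homog -> (0 < m)%N.
Proof. by move=> [p0 pu _]; apply: form_nonunit. Qed.

Lemma form_zero (p : S) m (i : 'I_3) : p \is m.-homog -> (0 < m)%N ->
  exists x, [/\ nonzero_pt x, p.@[x] = 0 & x i = 0].
Proof.
move=> hp m0; pose e (l k : 'I_3) : F := (k == l)%:R.
have [s [t [st p0]]] := homog_line_zero (e (i + 1)) (e (i + 2%:R)) hp m0.
have ii : [/\ i + 1 != i, i + 2%:R != i & i + 1 != i + 2%:R].
  by case: (i) => [[|[|[|]]]].
case: ii => i1 i2 i12.
exists (fun k => s * e (i + 1) k + t * e (i + 2%:R) k); split=> //.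
  case/orP: st => [s0|t0].
    by exists (i + 1); rewrite /e eqxx (negPf i12) mulr0 mulr1 addr0.
  by exists (i + 2%:R); rewrite /e eqxx [_ == i + 1]eq_sym (negPf i12) mulr0 mulr1 add0r.
by rewrite /e ![i == _]eq_sym (negPf i1) (negPf i2) !mulr0 addr0.
Qed.

Lemma rprime_not_dvd_vars (p : S) m i :
  rprime p -> p \is m.-homog -> rdvd p 'X_i -> forall j, j != i -> ~ rdvd p 'X_j.
Proof.
move=> pp hp [a pa] j ji [b pb].
pose e (l k : 'I_3) : F := (k == l)%:R.
have [s [t [st p0]]] := homog_line_zero (e i) (e j) hp (rprime_form_degree pp hp).
move/(congr1 (meval (fun k => s * e i k + t * e j k))): pa.
move/(congr1 (meval (fun k => s * e i k + t * e j k))): pb.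
rewrite !mevalM p0 !mevalXU !mulr0 /e !eqxx [i == j]eq_sym (negPf ji) !mulr0 !mulr1.
by rewrite addr0 add0r => t0 s0; rewrite s0 t0 eqxx in st.
Qed.

Lemma constant_section (I : finType) (p : S) m (N G : I -> S) D (x1 : 'I_3 -> F) :
    rprime p -> p \is m.-homog ->
    (forall i, G i \is D.-homog) -> (forall i, N i \is D.-homog) ->
    (forall x, nonzero_pt x -> p.@[x] = 0 -> exists i, (G i).@[x] != 0) ->
    (forall i j, rdvd p (N i * G j - N j * G i)) ->
    nonzero_pt x1 -> p.@[x1] = 0 -> (forall i, (N i).@[x1] = 0) ->
  forall i, rdvd p (N i).
Proof.
move=> pp hp hG hN ncz par x1n0 px1 Nx1.
have [p0 pu pP] := pp.
(* [None] carries [p]: a family without common zeros on the curve becomes one without common zeros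
   in the plane. *)
pose G' (o : option I) := if o is Some i then G i else p.
pose D' (o : option I) := if o is Some i then D else m.
have [||L [DL span]] := @projective_nullstellensatz F _ G' D'.
- by case.
- move=> x xn0; have [px|px] := eqVneq p.@[x] 0; last by exists None.
  by have [i Gi] := ncz x xn0 px; exists (Some i).
have [j Gj] := ncz x1 x1n0 px1.
have DleL : (D <= L)%N := DL (Some j).
(* Multiplication by the regular function [N / G] on the forms of degree [L]. *)
have mult (a : 'I_#|monos 3 L|) : exists2 t : S, t \is L.-homog
    & forall i, rdvd p ('X_[mono a] * N i - G i * t).
  have [|A hA AE] := span 'X_[@mono 3 L a]; first by rewrite dhomogX /= mdeg_mono.
  exists (\sum_l A (Some l) * N l).
    apply: rpred_sum => l _; have := dhomogM (hA (Some l)) (hN l).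
    by rewrite /= subnK.
  move=> i; rewrite AE sum_option /= mulrDl.
  rewrite [G i * _]mulrC !mulr_suml -addrA -sumrB; apply: rdvdD.
    by apply: rdvd_mulr; apply: rdvd_mull; apply: rdvd_refl.
  apply: rdvd_sum => l _.
  have -> : A (Some l) * G l * N i - A (Some l) * N l * G i =
    A (Some l) * (N i * G l - N l * G i) by ring.
  exact: rdvd_mull.
have /fin_all_exists2 [t ht tE] := mult.
pose c := \matrix_(a < #|monos 3 L|, b < #|monos 3 L|) (t a)@_(mono b).
have [s sE] := det_mpoly_pencil 3 c.
(* Modulo [p], [B] kills the vector of monomials of degree [L]. By the adjugate, [\det B] then kills
   each monomial, so it is itself a multiple of [p]. *)
pose B := (N j)%:M - G j *: map_mx (@mpolyC 3 F) c.
have BM a : rdvd p (\sum_b B a b * 'X_[mono b]).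
  have -> : \sum_b B a b * 'X_[mono b] = 'X_[mono a] * N j - G j * t a; last exact: tE.
  rewrite (form_expand (ht a)) mulr_sumr.
  rewrite (_ : 'X_[mono a] * N j = \sum_b (N j) *+ (a == b) * 'X_[mono b]).
    rewrite -sumrB; apply: eq_bigr => b _; rewrite !mxE mulrBl; congr (_ - _).
    by rewrite -mulrA mul_mpolyC.
  rewrite (bigD1 a) //= eqxx mulr1n mulrC big1 ?addr0 // => b ba.
  by rewrite eq_sym (negPf ba) mulr0n mul0r.
have detM (a : 'I_#|monos 3 L|) : rdvd p (\det B * 'X_[mono a]).
  have -> : \det B * 'X_[mono a] = \sum_b (\adj B) a b * \sum_d B b d * 'X_[mono d].
    under eq_bigr do rewrite mulr_sumr.
    have inner d : \sum_b (\adj B) a b * (B b d * 'X_[mono d]) =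
        (\det B *+ (a == d)) * 'X_[mono d].
      under eq_bigr do rewrite mulrA; rewrite -mulr_suml.
      by have /matrixP/(_ a d) := mul_adj_mx B; rewrite [LHS]mxE [RHS]mxE => ->.
    rewrite exchange_big /= (bigD1 a) //= inner eqxx mulr1n big1 ?addr0 // => d da.
    by rewrite inner eq_sym (negPf da) mulr0n mul0r.
  by apply: rdvd_sum => b _; apply: rdvd_mull.
have detB : rdvd p (\det B).
  have pX k : ~ rdvd p 'X_k -> rdvd p (\det B).
    move=> npk; have [|a aE] := @mono_onto 3 L (U_(k) *+ L)%MM.
      by rewrite mdegMn mdeg1 mul1n.
    have := detM a; rewrite aE -mpolyXn => /pP [//|/(rprime_exp pp)].
    by move/npk.
  have [p0X|/pX //] := classic (rdvd p 'X_ord0).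
  by apply: (pX ord_max); apply: (rprime_not_dvd_vars pp hp p0X).
rewrite /B sE in detB.
have [l [q lq]] := rprime_prod pp detB.
(* The eigenvalue is the value of N/G at [x1], where all [N i] vanish and [G j] does not. *)
have l0 : l = 0.
  move/(congr1 (meval x1)): lq; rewrite mevalB mevalZ mevalM px1 Nx1 mulr0 sub0r.
  by move/eqP; rewrite oppr_eq0 mulf_eq0 (negPf Gj) orbF => /eqP.
have pNj : rdvd p (N j) by exists q; rewrite -lq l0 scale0r subr0.
move=> i; have : rdvd p (N i * G j).
  rewrite -[N i * G j](subrK (N j * G i)); apply: rdvdD; first exact: par.
  exact: rdvd_mulr.
case/pP=> // -[g gE]; move: Gj; rewrite gE mevalM px1 mulr0 eqxx //.
Qed.

(** If [h] had no zero on the curve, the quotient of ['X_i ^+ b] by [h] would be a regular function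
    with a zero where the curve meets the line x_i = 0, hence identically zero. Then [p] would
    divide every variable. *)
Lemma prime_form_meets (p h : S) m b :
    rprime p -> p \is m.-homog -> h \is b.-homog -> (0 < b)%N ->
  exists x, [/\ nonzero_pt x, p.@[x] = 0 & h.@[x] = 0].
Proof.
move=> pp hp hh b0; apply: NNPP => no.
have pX i : rdvd p 'X_i.
  have [x1 [x1n0 px1 x1i]] := form_zero i hp (rprime_form_degree pp hp).
  apply: (rprime_exp (n := b)) => //.
  apply: (@constant_section unit p m (fun=> 'X_i ^+ b) (fun=> h) b x1) => //.
  - by move=> _; apply: dhomogXUn.
  - move=> x xn0 px; exists tt; apply/negP => /eqP hx.
    by apply: no; exists x.
  - by move=> _ _; rewrite subrr; apply: rdvd0.
  - by move=> _; rewrite rmorphXn /= mevalXU x1i expr0n eqn0Ngt b0.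
by apply: (@rprime_not_dvd_vars p m ord0 pp hp (pX _) ord_max).
Qed.

(* Two components of a reducible curve meet, and the curve is singular there. *)
Lemma smooth_form_prime (J : S) m : J \is m.-homog -> (0 < m)%N ->
    (forall x, nonzero_pt x -> J.@[x] = 0 -> exists j, (J^`M(j)).@[x] != 0) ->
  rprime J.
Proof.
move=> hJ m0 smooth; have J0 : J != 0.
  apply/negP => /eqP J0; have [||j] := smooth (fun=> 1); rewrite ?J0 ?meval0 //.
    by exists ord0; rewrite oner_eq0.
  by rewrite mderiv0 meval0 eqxx.
apply: mpoly_irred_prime; split=> //.
  rewrite mpoly_unitE; apply: contraTN m0 => /msize_poly1P [c c0 Jc].
  have h0 : J \is 0.-homog by rewrite Jc -alg_mpolyC rpredZ // dhomog1.
  by rewrite (dhomog_uniq J0 hJ h0).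
move=> a b Jab; apply: NNPP => nu.
have [ua ub] : a \isn't a GRing.unit /\ b \isn't a GRing.unit.
  by split; apply/negP => u; apply: nu; [left|right].
have [a0 b0] : a != 0 /\ b != 0.
  by apply/andP; move: J0; rewrite Jab mulf_eq0 negb_or.
have [kb hb] : exists k, b \is k.-homog.
  by apply: (@homog_factor _ _ J b a m) => //; rewrite mulrC.
have [ka ha] := homog_factor J0 hJ Jab.
have kb0 := form_nonunit b0 ub hb.
have af := mpoly_factorial a0; case: af Jab a0 ua ha {nu} => [u uu|p a' pp _] Jab a0 ua ha.
  by rewrite uu in ua.
have [kp hp] : exists k, p \is k.-homog by apply: (homog_factor a0 ha erefl).
have [x [xn0 px bx]] := prime_form_meets pp hp hb kb0.
have [//||j] := smooth x; first by rewrite Jab !mevalM px !mul0r.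
by rewrite Jab mderivM mevalD !mevalM px bx mul0r mulr0 mul0r addr0 eqxx.
Qed.

Lemma msize_mderiv n (p : {mpoly F[n]}) i : p^`M(i) != 0 -> (msize p^`M(i) < msize p)%N.
Proof.
move=> dp0; rewrite -(mlead_deg dp0).
have := mlead_supp dp0; rewrite mcoeff_msupp mcoeff_deriv => nz.
have : (mlead p^`M(i) + U_(i))%MM \in msupp p.
  by rewrite mcoeff_msupp; apply: contraNneq nz => ->; rewrite mul0rn.
by move/msize_mdeg_lt; rewrite mdegD mdeg1 addn1.
Qed.

Lemma rdvd_msize n (p q : {mpoly F[n]}) : rdvd p q -> q != 0 -> (msize p <= msize q)%N.
Proof.
move=> [c ->]; rewrite mulf_eq0 negb_or => /andP[c0 p0].
rewrite msizeM //; move: c0 p0; rewrite -2!msize_poly_eq0.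
by move: (msize c) (msize p) => x y; lia.
Qed.

Hypothesis charF0 : [pchar F] =i pred0.

Lemma mderiv_eq0_const n (p : {mpoly F[n]}) :
  (forall i, p^`M(i) = 0) -> p = (p@_0)%:MP.
Proof.
move=> dp; apply/mpolyP => m; rewrite mcoeffC.
have [->|m0] := eqVneq m 0%MM; first by rewrite ?eqxx mulr1.
rewrite 1?eq_sym ?(negPf m0) mulr0; have [i mi] : exists i, m i != 0%N.
  apply: NNPP => no; case/eqP: m0; apply/mnmP => i; rewrite mnm0E.
  by apply/eqP; apply: contraT => mi; case: no; exists i.
have := mcoeff_deriv i (m - U_(i))%MM p; rewrite dp mcoeff0 submK ?lep1mP //.
by move/esym/eqP; rewrite -mulr_natr mulf_eq0 (pcharf0P F).1 // orbF => /eqP.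
Qed.

(* [curve_deriv J i] is the derivation [J_z d_i - J_i d_z] tangent to [J = 0],
   with [z] the last variable. *)
Definition curve_deriv (J : S) i (p : S) : S :=
  J^`M(ord_max) * p^`M(i) - J^`M(i) * p^`M(ord_max).

Lemma curve_derivM J i p q :
  curve_deriv J i (p * q) = curve_deriv J i p * q + p * curve_deriv J i q.
Proof. by rewrite /curve_deriv !mderivM; ring. Qed.

Lemma curve_derivD J i p q :
  curve_deriv J i (p + q) = curve_deriv J i p + curve_deriv J i q.
Proof. by rewrite /curve_deriv !mderivD; ring. Qed.

Lemma curve_deriv_exp J i p N :
  p * curve_deriv J i (p ^+ N) = N%:R * curve_deriv J i p * p ^+ N.
Proof.
elim: N => [|N IH].
  by rewrite expr0 /curve_deriv -mpolyC1 !mderivC; ring.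
by rewrite exprS curve_derivM mulrDr [p * (p * _)]mulrCA IH -[in RHS]natr1; ring.
Qed.

(** Apply the derivation D to the last hypothesis and multiply by [Q * T]. D kills [J]; [Q * D R]
    returns to the ideal (J, R) by the third hypothesis; [T * D (T ^+ N)] is a multiple of [T ^+ N].
    As [w] is free of the last variable, D w is J_z times its i-th derivative, and [Q] times J_z is
    a new factor [T]; together with the multiplier [T] this gives the exponent [N.+2]. *)
Lemma curve_deriv_ideal J Q R w T i N a b s :
    T = Q * J^`M(ord_max) -> w^`M(ord_max) = 0 ->
    Q * curve_deriv J i R - R * curve_deriv J i Q = s * J ->
    T ^+ N * w = a * J + b * R ->
  exists a' b', T ^+ N.+2 * w^`M(i) = a' * J + b' * R.
Proof.
move=> TE wz dR Tw; set D := curve_deriv J i.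
have DJ : D J = 0 by rewrite /D /curve_deriv mulrC subrr.
have Dw : D w = J^`M(ord_max) * w^`M(i) by rewrite /D /curve_deriv wz mulr0 subr0.
have := congr1 (curve_deriv J i) Tw; rewrite curve_derivD 3!curve_derivM -/D DJ Dw mulr0 addr0.
move/(canRL (addKr _)) => E.
have e2 := curve_deriv_exp J i T N; rewrite -/D in e2.
exists (Q * (T * D a - N%:R * D T * a + b * J^`M(ord_max) * s)).
exists (Q * (T * D b - N%:R * D T * b + b * J^`M(ord_max) * D Q)).
have -> : T ^+ N.+2 * w^`M(i) = Q * (T * (T ^+ N * (J^`M(ord_max) * w^`M(i)))).
  by rewrite !exprS {2}TE; ring.
rewrite E mulrDr mulrN [T * (D (T ^+ N) * w)]mulrA e2.
rewrite -[N%:R * D T * T ^+ N * w]mulrA Tw.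
have dR' : Q * D R = s * J + R * D Q by rewrite -dR subrK.
have -> : T * (D a * J + (D b * R + b * D R)) =
    T * D a * J + T * D b * R + b * J^`M(ord_max) * (Q * D R).
  by rewrite TE; ring.
by rewrite dR'; ring.
Qed.

(** The constant is the value of P/Q at a point [x0] of the curve where [T] is nonzero. If [J] did
    not divide [R], there would be an eliminant [w] of [J] and [R]. The zero derivative keeps all
    partial derivatives of [w] in the ideal (J, R) up to powers of [T], so in characteristic 0
    repeated differentiation ends at a nonzero constant. This contradicts the vanishing of [J] and
    [R] at [x0]. *)
Lemma zero_derivative_constant (J P Q : S) :
    rprime J -> J^`M(ord_max) != 0 -> ~ rdvd J Q ->
    (forall i j, rdvd J ((Q * P^`M(i) - P * Q^`M(i)) * J^`M(j)
                       - (Q * P^`M(j) - P * Q^`M(j)) * J^`M(i))) ->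
  exists c, rdvd J (P - c *: Q).
Proof.
move=> pJ Jz JQ dPQ; have [J0 _ JP] := pJ.
pose T := Q * J^`M(ord_max).
have JT : ~ rdvd J T.
  move=> /JP [//|/rdvd_msize/(_ Jz)]; have := msize_mderiv Jz.
  by move: (msize J) (msize _) => x y; lia.
have [x0 [_ Jx0 Tx0]] := rprime_nonvanishing pJ Jz JT.
have Qx0 : Q.@[x0] != 0.
  by apply: contraNneq Tx0; rewrite mevalM => ->; rewrite mul0r.
pose c := P.@[x0] / Q.@[x0]; exists c; set R := P - c *: Q.
apply: NNPP => JR.
have Rx0 : R.@[x0] = 0 by rewrite mevalB mevalZ divfK // subrr.
have [a0 [b0 [w0 [w0n0 w0E]]]] := mpoly_eliminant pJ Jz JR.
suff main k (w : S) : (msize w <= k)%N -> w != 0 -> w^`M(ord_max) = 0 ->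
    (exists N a b, T ^+ N * w = a * J + b * R) -> False.
  apply: (main _ (mwiden w0) (leqnn _)).
  - by apply: contraNneq w0n0 => e; apply/eqP/(@inj_mwiden 2 F); rewrite e mwiden0.
  - exact: mderiv_mwiden.
  - by exists 0%N, a0, b0; rewrite expr0 mul1r.
elim: k w => [|k IH] w.
  by rewrite leqn0 msize_poly_eq0 => ->.
move=> wk wn0 wz [N [a [b wI]]].
have [wC|] := classic (forall i, w^`M(i) = 0).
  have := mderiv_eq0_const wC; set c0 := _@_0 => wE.
  have c0n0 : c0 != 0 by move: wn0; rewrite wE mpolyC_eq0.
  move: (congr1 (meval x0) wI); rewrite mevalD !mevalM Jx0 Rx0 wE mevalC !mulr0 addr0.
  by move/eqP; rewrite mulf_eq0 (negPf c0n0) orbF rmorphXn expf_eq0 /= (negPf Tx0) andbF.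
move=> /not_all_ex_not [i /eqP wi]; apply: (IH w^`M(i)) => //.
- by have := msize_mderiv wi; move: wk; move: (msize w) (msize _) => x y; lia.
- by rewrite mderiv_comm wz mderiv0.
have [s sE] := dPQ i ord_max.
exists N.+2; apply: (@curve_deriv_ideal J Q R w T i N a b s) => //.
rewrite -sE /curve_deriv /R !mderivB !mderivZ -!mul_mpolyC; ring.
Qed.

End PlaneCurves.

(** * Three by three matrices *)

Definition o0 : 'I_3 := inord 0.
Definition o1 : 'I_3 := inord 1.
Definition o2 : 'I_3 := inord 2.

Definition nx (i : 'I_3) : 'I_3 := if i == o0 then o1 else if i == o1 then o2 else o0.

Lemma nx0 : nx o0 = o1. Proof. by rewrite /nx eqxx. Qed.
Lemma nx1 : nx o1 = o2.
Proof. by rewrite /nx eqxx -val_eqE /= !inordK. Qed.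
Lemma nx2 : nx o2 = o0.
Proof. by rewrite /nx -!val_eqE /= !inordK. Qed.
Definition nxE := (nx0, nx1, nx2).

Lemma ord3P (i : 'I_3) : [\/ i = o0, i = o1 | i = o2].
Proof.
case: i => [[|[|[|//]]]] h; [constructor 1|constructor 2|constructor 3];
  by apply: val_inj; rewrite /= inordK.
Qed.

Lemma sum3 (V : nmodType) (f : 'I_3 -> V) : \sum_i f i = f o0 + f o1 + f o2.
Proof.
rewrite !big_ord_recl big_ord0 addr0 addrA; congr (_ + _ + _); congr f;
  by apply: val_inj; rewrite /= inordK.
Qed.

Section Cofactors.
Variable R : comNzRingType.
Implicit Types (A B : 'I_3 -> 'I_3 -> R) (g u v w x : 'I_3 -> R).

(* The indices are cyclic, so that no signs are needed. *)
Definition cof A i j :=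
  A (nx i) (nx j) * A (nx (nx i)) (nx (nx j)) - A (nx i) (nx (nx j)) * A (nx (nx i)) (nx j).

Definition det3 A := \sum_j A o0 j * cof A o0 j.

Lemma cof_mul A B i j :
  cof (fun i j => \sum_k A i k * B k j) i j = \sum_k cof A i k * cof B k j.
Proof.
rewrite /cof !sum3; case: (ord3P i) => ->; case: (ord3P j) => ->;
  rewrite !nxE; ring.
Qed.

Lemma cof_cof A i j : cof (cof A) i j = det3 A * A i j.
Proof.
rewrite /det3 !sum3 /cof; case: (ord3P i) => ->; case: (ord3P j) => ->;
  rewrite !nxE; ring.
Qed.

Lemma nx3 i : nx (nx (nx i)) = i.
Proof. by case: (ord3P i) => ->; rewrite !nxE. Qed.

Lemma ord3_nx i j : [\/ j = i, j = nx i | j = nx (nx i)].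
Proof.
by case: (ord3P i) => ->; case: (ord3P j) => ->; rewrite !nxE;
  first [by constructor 1 | by constructor 2 | by constructor 3].
Qed.

(** A singular matrix has a cofactor matrix of rank at most 1, because the cofactors of [cof A] are
    [det3 A] times the entries of [A]. The cases bring the rows and columns into cyclic order. *)
Lemma cof_minor A i j k l :
  det3 A = 0 -> cof A i j * cof A k l = cof A k j * cof A i l.
Proof.
move=> d0; have C p q : cof A (nx p) (nx q) * cof A (nx (nx p)) (nx (nx q)) =
    cof A (nx p) (nx (nx q)) * cof A (nx (nx p)) (nx q).
  by apply/eqP; rewrite -subr_eq0 -/(cof (cof A) p q) cof_cof d0 mul0r.
case: (ord3_nx i k) => ->; first by [].
  case: (ord3_nx j l) => ->; first by rewrite mulrC.
    by have := C (nx (nx i)) (nx (nx j)); rewrite !nx3 => ->; rewrite mulrC.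
  by have := C (nx (nx i)) (nx j); rewrite !nx3 => <-; rewrite mulrC.
case: (ord3_nx j l) => ->; first by rewrite mulrC.
  by have := C (nx i) (nx (nx j)); rewrite !nx3 => e; rewrite mulrC e mulrC.
by have := C (nx i) (nx j); rewrite !nx3 => e; rewrite mulrC e mulrC.
Qed.

(* [cof A] maps [u * v] (cross product) to [A u * A v]; hence, when the row
   vector [G A] is proportional to [g], the vector [cof A g] is to [G]. *)
Lemma cof_parallel A g G q i k :
    (forall j, \sum_l G l * A l j = q * g j) ->
  (\sum_j cof A i j * g j) * G k = (\sum_j cof A k j * g j) * G i.
Proof.
move=> GA; have e0 := GA o0; have e1 := GA o1; have e2 := GA o2.
rewrite !sum3 in e0 e1 e2.
apply/eqP; rewrite -subr_eq0; apply/eqP; rewrite !sum3 /cof.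
pose E j := G o0 * A o0 j + G o1 * A o1 j + G o2 * A o2 j.
(* Up to sign, the determinant of [g], the vector G A and the row [A l]; it vanishes because G A = q
   g. *)
pose K l := g o0 * (A l o2 * E o1 - A l o1 * E o2) +
            g o1 * (A l o0 * E o2 - A l o2 * E o0) +
            g o2 * (A l o1 * E o0 - A l o0 * E o1).
have K0 l : K l = 0 by rewrite /K /E e0 e1 e2; ring.
case: (ord3P i) => ->; case: (ord3P k) => ->; rewrite !nxE; try ring.
- by rewrite -(K0 o2) /K /E; ring.
- by rewrite -[RHS]oppr0 -(K0 o1) /K /E; ring.
- by rewrite -[RHS]oppr0 -(K0 o2) /K /E; ring.
- by rewrite -(K0 o0) /K /E; ring.
- by rewrite -(K0 o1) /K /E; ring.
- by rewrite -[RHS]oppr0 -(K0 o0) /K /E; ring.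
Qed.

Definition cross u v i := u (nx i) * v (nx (nx i)) - u (nx (nx i)) * v (nx i).

(* [(v.x) u - (u.x) v = x * (u * v)], and [(x * c) * g = c (x.g) - x (c.g)]. *)
Lemma tangent_parallel u v x g a b :
    \sum_i x i * g i = 0 -> \sum_i cross u v i * g i = 0 ->
  let ux := \sum_i u i * x i in let vx := \sum_i v i * x i in
  (vx * u a - ux * v a) * g b = (vx * u b - ux * v b) * g a.
Proof.
move=> /= xg cg; apply/eqP; rewrite -subr_eq0; apply/eqP.
pose c := cross u v.
pose K i := c i * (\sum_i x i * g i) - x i * (\sum_i c i * g i).
have K0 i : K i = 0 by rewrite /K xg cg; ring.
rewrite /K /c !sum3 /cross !nxE in K0; rewrite !sum3.
have k0 := K0 o0; have k1 := K0 o1; have k2 := K0 o2; rewrite !nxE in k0 k1 k2.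
case: (ord3P a) => ->; case: (ord3P b) => ->; try ring.
- by rewrite -k2; ring.
- by rewrite -[RHS]oppr0 -k1; ring.
- by rewrite -[RHS]oppr0 -k2; ring.
- by rewrite -k0; ring.
- by rewrite -k1; ring.
- by rewrite -[RHS]oppr0 -k0; ring.
Qed.

Lemma det3E A : \det (\matrix_(i < 3, j < 3) A i j) = det3 A.
Proof.
rewrite (expand_det_row _ o0) /det3; apply: eq_bigr => j _; rewrite mxE; congr (_ * _).
rewrite /cofactor (expand_det_row _ ord0) !big_ord_recl big_ord0 /cofactor !det_mx11 !mxE.
have l00 : lift o0 ord0 = o1 by apply: val_inj; rewrite /= /bump !inordK.
have l01 : lift o0 (lift ord0 0) = o2 by apply: val_inj; rewrite /= /bump !inordK.
have l10 : lift o1 ord0 = o0 by apply: val_inj; rewrite /= /bump !inordK.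
have l11 : lift o1 (lift ord0 0) = o2 by apply: val_inj; rewrite /= /bump !inordK.
have l20 : lift o2 ord0 = o0 by apply: val_inj; rewrite /= /bump !inordK.
have l21 : lift o2 (lift ord0 0) = o1 by apply: val_inj; rewrite /= /bump !inordK.
have -> : lift (lift ord0 ord0) 0 = ord0 :> 'I_2 by apply: val_inj.
have -> : lift ord0 ord0 = lift ord0 0 :> 'I_2 by apply: val_inj.
rewrite [nat_of_ord o0]inordK // /cof l00 l01.
by case: (ord3P j) => ->; rewrite ?(l00, l01, l10, l11, l20, l21) !nxE inordK //=; ring.
Qed.

End Cofactors.

(** * Maps with smooth critical locus *)

Section CriticalLocus.
Variable F : closedFieldType.
Notation S := {mpoly F[3]}.
Implicit Types (f h : triple F) (p q J : S) (x : 'I_3 -> F).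

Definition jac f i j : S := (f i)^`M(j).

Definition comp3 p f : S := p \mPo [tuple f i | i < 3].

Lemma meval_comp3 p f x : (comp3 p f).@[x] = p.@[fapp f x].
Proof.
by rewrite comp_mpoly_meval; apply: meval_eq => i; rewrite tnth_mktuple.
Qed.

Lemma dhomog_comp3 p f d e :
  p \is d.-homog -> (forall i, f i \is e.-homog) -> comp3 p f \is (d * e).-homog.
Proof. by move=> hp hf; apply: dhomog_comp => // i; rewrite tnth_mktuple. Qed.

Lemma mderiv_comp3 p f j :
  (comp3 p f)^`M(j) = \sum_i comp3 (p^`M(i)) f * (f i)^`M(j).
Proof.
elim/mpoly_ring_ind: p => [c|i|p q IHp IHq|p q IHp IHq].
- rewrite /comp3 comp_mpolyC mderivC big1 // => i _.
  by rewrite mderivC comp_mpoly0 mul0r.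
- rewrite /comp3 comp_mpolyXU -tnth_nth tnth_mktuple (bigD1 i) //= big1 => [|k ki].
    have subii : (U_(i) - U_(i) = 0 :> 'X_{1..3})%MM.
      by apply/mnmP=> k; rewrite mnmBE subnn mnm0E.
    by rewrite mderivX mnm1E eqxx subii mpolyX0 mulr1n scale1r comp_mpoly1 mul1r addr0.
  by rewrite mderivX mnm1E eq_sym (negPf ki) mulr0n scale0r comp_mpoly0 mul0r.
- rewrite /comp3 comp_mpolyD mderivD -/(comp3 _ _) IHp -/(comp3 _ _) IHq -big_split /=.
  by apply: eq_bigr => i _; rewrite mderivD /comp3 comp_mpolyD mulrDl.
- rewrite /comp3 rmorphM mderivM -/(comp3 _ _) IHp -/(comp3 _ _) IHq.
  rewrite mulr_suml mulr_sumr -big_split /=; apply: eq_bigr => i _.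
  by rewrite mderivM /comp3 comp_mpolyD !rmorphM /=; ring.
Qed.

Definition cofv (R : comNzRingType) (A : 'I_3 -> 'I_3 -> R) (g : 'I_3 -> R) i : R :=
  \sum_j cof A i j * g j.

Lemma meval_cof (A : 'I_3 -> 'I_3 -> S) x i j :
  (cof A i j).@[x] = cof (fun i j => (A i j).@[x]) i j.
Proof. by rewrite /cof mevalB !mevalM. Qed.

Lemma meval_cofv (A : 'I_3 -> 'I_3 -> S) g x i :
  (cofv A g i).@[x] = cofv (fun i j => (A i j).@[x]) (fun j => (g j).@[x]) i.
Proof. by rewrite raddf_sum /=; apply: eq_bigr => j _; rewrite mevalM meval_cof. Qed.

Lemma meval_det3 (A : 'I_3 -> 'I_3 -> S) x :
  (det3 A).@[x] = det3 (fun i j => (A i j).@[x]).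
Proof. by rewrite raddf_sum /=; apply: eq_bigr => j _; rewrite mevalM meval_cof. Qed.

Lemma dhomog_cof (A : 'I_3 -> 'I_3 -> S) e i j :
  (forall i j, A i j \is e.-homog) -> cof A i j \is (e + e).-homog.
Proof. by move=> hA; rewrite rpredB // dhomogM. Qed.

Lemma dhomog_cofv (A : 'I_3 -> 'I_3 -> S) g e b i :
    (forall i j, A i j \is e.-homog) -> (forall j, g j \is b.-homog) ->
  cofv A g i \is (e + e + b).-homog.
Proof. by move=> hA hg; apply: rpred_sum => j _; rewrite dhomogM // dhomog_cof. Qed.

Lemma jacdetE f : jacdet f = det3 (jac f).
Proof. by rewrite -det3E. Qed.

Lemma dhomog_jac f d : (forall i, f i \is d.-homog) ->
  forall i j, jac f i j \is d.-1.-homog.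
Proof. by move=> hf i j; apply: dhomog_mderiv. Qed.

Lemma dhomog_jacdet f d : (forall i, f i \is d.-homog) ->
  jacdet f \is (d.-1 + (d.-1 + d.-1)).-homog.
Proof.
move=> /dhomog_jac hf; rewrite jacdetE; apply: rpred_sum => j _.
by rewrite dhomogM // dhomog_cof.
Qed.

Lemma rdvd_vanishing (J h : S) : rprime J -> J^`M(ord_max) != 0 ->
  (forall x, nonzero_pt x -> J.@[x] = 0 -> h.@[x] = 0) -> rdvd J h.
Proof.
move=> pJ dJ van; apply: NNPP => /(rprime_nonvanishing pJ dJ) [x [xn0 Jx]].
by rewrite van ?eqxx.
Qed.

Lemma euler_eval p m x :
  p \is m.-homog -> \sum_i x i * (p^`M(i)).@[x] = m%:R * p.@[x].
Proof.
move=> hp; rewrite -mevalZ -(euler_form hp) raddf_sum /=.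
by apply: eq_bigr => i _; rewrite mevalM mevalXU.
Qed.

Hypothesis charF0 : [pchar F] =i pred0.

Let natF_eq0 n : (n%:R == 0 :> F) = (n == 0)%N.
Proof. exact: (pcharf0P F).1 charF0 n. Qed.

Lemma smooth_gradient J m : J \is m.-homog -> (0 < m)%N ->
    (forall x, nonzero_pt x -> J.@[x] = 0 -> exists j, (J^`M(j)).@[x] != 0) ->
  forall x, nonzero_pt x -> exists j, (J^`M(j)).@[x] != 0.
Proof.
move=> hJ m0 sm x xn0; apply: NNPP => no.
have g0 j : (J^`M(j)).@[x] = 0.
  by apply/eqP; apply: contraT => h; case: no; exists j.
apply: no; apply: sm => //; have := euler_eval x hJ.
rewrite big1 => [|i _]; last by rewrite g0 mulr0.
by move/esym/eqP; rewrite mulf_eq0 natF_eq0 eqn0Ngt m0 => /eqP.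
Qed.

(** Otherwise the curve is a cone with vertex at the i-th coordinate point, where all partial
    derivatives, being of positive degree, vanish. *)
Lemma smooth_partial_neq0 J m i : J \is m.-homog -> (1 < m)%N ->
    (forall x, nonzero_pt x -> exists j, (J^`M(j)).@[x] != 0) ->
  J^`M(i) != 0.
Proof.
move=> hJ m1 grad; apply/negP => /eqP Ji.
have [|j] := grad (fun k => (k == i)%:R); first by exists i; rewrite eqxx oner_eq0.
have := euler_eval (fun k => (k == i)%:R) (dhomog_mderiv j hJ).
rewrite big1 => [/esym/eqP|k _].
  by rewrite mulf_eq0 natF_eq0 (_ : (m.-1 == 0)%N = false) => [/=->|]; last by lia.
have [->|_] := eqVneq k i; last by rewrite mul0r.
by rewrite mderiv_comm Ji mderiv0 meval0 mulr0.
Qed.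

Lemma msize_form n (p : {mpoly F[n]}) m : p != 0 -> p \is m.-homog -> msize p = m.+1.
Proof. by move=> p0 /dhomog_mf hp; rewrite -(mlead_deg p0) -(hp _ (mlead_supp p0)). Qed.

Lemma form_not_dvd_var J m i : rprime J -> J \is m.-homog -> (1 < m)%N -> ~ rdvd J 'X_i.
Proof.
move=> [J0 _ _] hJ m1 /rdvd_msize; rewrite -msize_poly_eq0 msizeX => /(_ isT).
by rewrite (msize_form J0 hJ) mdeg1 ltnNge m1.
Qed.

(* Otherwise the columns of the cofactor matrix, divided by the nowhere
   vanishing section [cof(Df) grad J], would be constant on the critical curve. *)
Lemma degenerate_critical_point f d (J := jacdet f) :
    (1 < d)%N -> (forall i, f i \is d.-homog) -> rprime J ->
    (forall x, nonzero_pt x -> exists j, (J^`M(j)).@[x] != 0) ->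
  exists x, [/\ nonzero_pt x, J.@[x] = 0
    & forall i, (cofv (jac f) (fun j => J^`M(j)) i).@[x] = 0].
Proof.
move=> d1 hf pJ grad; have hJ : J \is _.-homog := dhomog_jacdet hf.
set m := (_ + _)%N in hJ; have m1 : (1 < m)%N by rewrite /m; lia.
have Jz := smooth_partial_neq0 ord_max hJ m1 grad.
apply: NNPP => no; set n := cofv (jac f) (fun j => J^`M(j)).
have [x1 [x1n0 Jx1 x10]] := form_zero o0 hJ (ltnW m1).
have hA := dhomog_jac hf.
have hn i : n i \is (d.-1 + d.-1 + m.-1).-homog.
  by apply: dhomog_cofv => // j; apply: dhomog_mderiv.
have noz x : nonzero_pt x -> J.@[x] = 0 -> exists i, (n i).@[x] != 0.
  move=> xn0 Jx; apply: NNPP => nz; apply: no; exists x; split=> // i.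
  by apply/eqP; apply: contraT => h; case: nz; exists i.
have Jcof i j : rdvd J (cof (jac f) i j).
  have [_ _ JP] := pJ.
  (* The power of ['X_o0] equalizes the degrees and also supplies the zero at [x1], which was chosen
     on the line x_0 = 0. *)
  have : rdvd J (cof (jac f) i j * 'X_o0 ^+ m.-1).
    apply: (@constant_section F _ J m (fun i => cof (jac f) i j * 'X_o0 ^+ m.-1) n
      (d.-1 + d.-1 + m.-1) x1) => // [k|k l|k].
    - by rewrite dhomogM ?dhomog_cof ?dhomogXUn.
    (* On the curve Df is singular, so each column of its cofactor matrix is parallel to the
       combination [n] of these columns. *)
    - apply: rdvd_vanishing => // x _ Jx; apply/eqP.
      rewrite mevalB !mevalM !meval_cof !meval_cofv subr_eq0; apply/eqP.
      rewrite mulrAC [in RHS]mulrAC; congr (_ * _); rewrite /cofv !mulr_sumr; apply: eq_bigr => a _.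
      rewrite !mulrA; congr (_ * _); apply: cof_minor.
      by rewrite -(meval_det3 (jac f)) -jacdetE.
    - rewrite mevalM rmorphXn /= mevalXU x10 expr0n (_ : (m.-1 == 0)%N = false) ?mulr0 //.
      by lia.
  by case/JP => // /(rprime_exp pJ) /(form_not_dvd_var pJ hJ m1).
have [i] := noz x1 x1n0 Jx1; rewrite /n /cofv raddf_sum big1 ?eqxx // => j _ /=.
by have [c ->] := Jcof i j; rewrite !mevalM Jx1 mulr0 mul0r.
Qed.

(** [f] is applied first, so that Df is the right-hand factor in the chain rule. *)
Fixpoint iter_triple f k : triple F :=
  if k is k'.+1 then fun i => comp3 (iter_triple f k' i) f else fun i => 'X_i.

Lemma fapp_iter_triple f k x : fapp (iter_triple f k) x =1 iter k (fapp f) x.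
Proof.
elim: k x => [|k IH] x i; first by rewrite /fapp /= mevalXU.
by rewrite iterSr -IH /fapp /= meval_comp3.
Qed.

Lemma dhomog_iter_triple f d k i :
  (forall i, f i \is d.-homog) -> iter_triple f k i \is (d ^ k).-homog.
Proof.
move=> hf; elim: k i => [|k IH] i; first by rewrite expn0; apply: dhomogXU.
by rewrite expnSr; apply: dhomog_comp3.
Qed.

Lemma jac_comp f h i j :
  jac (fun i => comp3 (h i) f) i j = \sum_l comp3 (jac h i l) f * jac f l j.
Proof. exact: mderiv_comp3. Qed.

Lemma iter_fapp_nonzero f d k x :
  End2 d f -> nonzero_pt x -> nonzero_pt (iter k (fapp f) x).
Proof. by move=> [_ fn0] xn0; elim: k => //= k IH; apply: fn0. Qed.

(** The cross product of two distinct rows of [A] is, up to sign, the remaining row of the cofactor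
    matrix. *)
Lemma cross_rows (R : comNzRingType) (A : 'I_3 -> 'I_3 -> R) g i k :
  (forall l, cofv A g l = 0) -> \sum_c cross (A i) (A k) c * g c = 0.
Proof.
move=> c0; case: (ord3_nx i k) => ->.
- by rewrite big1 // => c _; rewrite /cross mulrC [X in _ - X]mulrC subrr mulr0.
- by apply: etrans (c0 (nx (nx i))); apply: eq_bigr => c _; rewrite /cof nx3.
- rewrite -[RHS]oppr0; apply: etrans (congr1 -%R (c0 (nx i))).
  rewrite /cofv -sumrN; apply: eq_bigr => c _.
  by rewrite /cof /cross nx3; ring.
Qed.

Lemma eq_cofv (R : comNzRingType) (A B : 'I_3 -> 'I_3 -> R) g i :
  (forall i j, A i j = B i j) -> cofv A g i = cofv B g i.
Proof. by move=> e; apply: eq_bigr => j _; rewrite /cof !e. Qed.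

(** An iterate enters as a map [G] without base points that factors through [f]; the factorization
    passes the zero [x1] on from [f] to [G]. *)
Lemma critical_curve_not_invariant d f h G D (J := jacdet f) :
    (1 < d)%N -> (forall i, f i \is d.-homog) -> crit_smooth f ->
    (0 < D)%N -> (forall i, G i \is D.-homog) -> (forall i, G i = comp3 (h i) f) ->
    (forall x, nonzero_pt x -> nonzero_pt (fapp G x)) ->
  ~ (forall x, nonzero_pt x -> J.@[x] = 0 -> J.@[fapp G x] = 0).
Proof.
move=> d1 hf sm D0 hG Gf Gn0 inv.
have hJ : J \is _.-homog := dhomog_jacdet hf.
set m := (_ + _)%N in hJ; have m1 : (1 < m)%N by rewrite /m; lia.
have sm' x : nonzero_pt x -> J.@[x] = 0 -> exists j, (J^`M(j)).@[x] != 0.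
  by move=> xn0 Jx; apply: sm.
have pJ : rprime J := smooth_form_prime hJ (ltnW m1) sm'.
have grad := smooth_gradient hJ (ltnW m1) sm'.
have Jz := smooth_partial_neq0 ord_max hJ m1 grad.
have [x1 [x1n0 Jx1 nx1]] := degenerate_critical_point d1 hf pJ grad.
have [q qE] : rdvd J (comp3 J G).
  by apply: rdvd_vanishing => // x xn0 Jx; rewrite meval_comp3 inv.
pose g j := J^`M(j).
have [H HE] : exists H, forall i, H i = comp3 (g i) G by exists (fun i => comp3 (g i) G).
have HA x : J.@[x] = 0 -> forall j,
    \sum_l (H l).@[x] * (jac G l j).@[x] = q.@[x] * (g j).@[x].
  move=> Jx j; have := mderiv_comp3 J G j; rewrite qE mderivM.
  move/(congr1 (meval x)); rewrite mevalD 2!mevalM Jx mulr0 add0r => ->.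
  by rewrite raddf_sum /=; apply: eq_bigr => l _; rewrite mevalM HE.
have par a b : rdvd J (cofv (jac G) g a * H b - cofv (jac G) g b * H a).
  apply: rdvd_vanishing => // x _ Jx; apply/eqP.
  rewrite mevalB 2!mevalM 2!meval_cofv subr_eq0; apply/eqP.
  exact: (cof_parallel _ _ (HA x Jx)).
(* cof(DG) is the product of cof(Dh), taken at [f], with cof(Df), and the latter already kills the
   gradient at [x1]. *)
have Gx1 a : (cofv (jac G) g a).@[x1] = 0.
  rewrite meval_cofv.
  rewrite (@eq_cofv _ _ (fun i j => \sum_l (comp3 (jac h i l) f).@[x1] * (jac f l j).@[x1])).
    rewrite /cofv; under eq_bigr do rewrite cof_mul mulr_suml.
    rewrite exchange_big big1 //= => l _.
    under eq_bigr do rewrite -mulrA; rewrite -mulr_sumr.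
    by have := nx1 l; rewrite meval_cofv /cofv => ->; rewrite mulr0.
  move=> i j; rewrite /jac Gf -[_^`M(_)]/(jac (fun i => comp3 (h i) f) i j).
  by rewrite jac_comp raddf_sum /=; apply: eq_bigr => l _; rewrite mevalM.
have hN i : cofv (jac G) g i \is (D.-1 + D.-1 + m.-1).-homog.
  by apply: dhomog_cofv => [a b|b]; apply: dhomog_mderiv.
have Jcofv i : rdvd J (cofv (jac G) g i).
  (* [r] is the degree of [H] minus that of cof(DG) g, and m >= 3. It can be 0, so the zero at [x1]
     has to come from [Gx1] and not from the power of ['X_o0]. *)
  have [_ _ JP] := pJ; pose r := ((D - 1) * (m - 3))%N.
  have Nr : (m.-1 * D = D.-1 + D.-1 + m.-1 + r)%N.
    by rewrite /r; move: m1 D0; rewrite /m; clear; nia.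
  have : rdvd J (cofv (jac G) g i * 'X_o0 ^+ r).
    apply: (@constant_section F _ J m (fun i => cofv (jac G) g i * 'X_o0 ^+ r) H
      (m.-1 * D)%N x1) => // [l|l|x xn0 Jx|a b|a].
    - by rewrite HE; apply: dhomog_comp3 => //; apply: dhomog_mderiv.
    - by rewrite Nr; apply: dhomogM (hN l) (dhomogXUn _ _ _).
    - by have [j gj] := grad _ (Gn0 x xn0); exists j; rewrite HE meval_comp3.
    - rewrite mulrAC [X in _ - X]mulrAC -mulrBl; apply: rdvd_mulr; exact: par.
    - by rewrite mevalM Gx1 mul0r.
  by case/JP => // /(rprime_exp pJ) /(form_not_dvd_var pJ hJ m1).
have [x0 [x0n0 Jx0 _]] := form_zero o0 hJ (ltnW m1).
have [j0 Gj0] := Gn0 _ x0n0.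
have JGj0 : ~ rdvd J (G j0).
  by move=> [c cE]; move: Gj0; rewrite /fapp cE mevalM Jx0 mulr0 eqxx.
(* By Euler's formula D G_l is the product of the l-th row of DG with x. So [tangent_parallel],
   applied to two rows, says that the differential of G_i/G_j0 is proportional to the gradient of
   [J], that is, zero along the curve. *)
have cst i : exists c, rdvd J (G i - c *: G j0).
  apply: zero_derivative_constant => // a b; apply: rdvd_vanishing => // x _ Jx.
  apply/eqP; rewrite mevalB subr_eq0; apply/eqP.
  have D0' : D%:R != 0 :> F by rewrite natF_eq0 -lt0n.
  have eul l : \sum_c (jac G l c).@[x] * x c = D%:R * (G l).@[x].
    by rewrite -(euler_eval x (hG l)); apply: eq_bigr => c _; rewrite mulrC.
  have xg : \sum_c x c * (g c).@[x] = 0 by rewrite (euler_eval x hJ) Jx mulr0.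
  have cg : \sum_c cross (fun c => (jac G i c).@[x]) (fun c => (jac G j0 c).@[x]) c
      * (g c).@[x] = 0.
    apply: (@cross_rows _ (fun i c => (jac G i c).@[x])) => l.
    by have [c cE] := Jcofv l; rewrite -(meval_cofv (jac G) g) cE mevalM Jx mulr0.
  have := tangent_parallel a b xg cg; rewrite /= 2!eul => tp.
  rewrite 2!mevalM 2!mevalB 4!mevalM.
  have scale P Pa Q Qa gb : D%:R * ((Q * Pa - P * Qa) * gb) =
    (D%:R * Q * Pa - D%:R * P * Qa) * gb :> F by ring.
  by apply: (mulfI D0'); rewrite 2!scale; exact: tp.
have [y [yn0 Jy Gy]] := prime_form_meets pJ hJ (hG j0) D0.
have [i] := Gn0 _ yn0; rewrite /fapp; have [c [b bE]] := cst i.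
by rewrite -[G i](subrK (c *: G j0)) bE mevalD mevalM mevalZ Jy Gy !mulr0 addr0 eqxx.
Qed.

Lemma smooth_critical_not_periodic d f :
  (1 < d)%N -> End2 d f -> crit_smooth f -> ~ postcrit_periodic f.
Proof.
move=> d1 Ef sm [[//|k] _ per]; have [hf fn0] := Ef.
apply: (@critical_curve_not_invariant d f (iter_triple f k) (iter_triple f k.+1)
  (d ^ k.+1)%N) => //.
- by rewrite expn_gt0 ltnW.
- by move=> i; apply: dhomog_iter_triple.
- move=> x /(iter_fapp_nonzero k.+1 Ef) [i hi]; exists i.
  by rewrite fapp_iter_triple.
move=> x xn0 Jx; have [_ <-] := per x (conj xn0 Jx).
by apply: meval_eq; apply: fapp_iter_triple.
Qed.

End CriticalLocus.

(** * Openness *)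

Section PolynomialFunctions.
Variables (F : closedFieldType) (d : nat).
Notation S := {mpoly F[3]}.

(** Agreement is required on forms of degree [d] only, since [coords] sees no other coefficients. *)
Definition polyfun k (phi : triple F -> F) :=
  exists2 P : {mpoly F[#|cidx d|]}, P \is k.-homog
    & forall f, (forall i, f i \is d.-homog) -> phi f = P.@[@coords F d f].

Lemma eq_polyfun k phi psi : phi =1 psi -> polyfun k phi -> polyfun k psi.
Proof. by move=> e [P hP PE]; exists P => // f hf; rewrite -e PE. Qed.

Lemma polyfun0 k : polyfun k (fun=> 0).
Proof. by exists 0; rewrite ?rpred0 // => f _; rewrite meval0. Qed.

Lemma polyfunD k phi psi :
  polyfun k phi -> polyfun k psi -> polyfun k (fun f => phi f + psi f).
Proof.
move=> [P hP PE] [Q hQ QE]; exists (P + Q); rewrite ?rpredD // => f hf.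
by rewrite mevalD PE ?QE.
Qed.

Lemma polyfunZ k c phi : polyfun k phi -> polyfun k (fun f => c * phi f).
Proof.
move=> [P hP PE]; exists (c *: P); rewrite ?rpredZ // => f hf.
by rewrite mevalZ PE.
Qed.

Lemma polyfunC c : polyfun 0 (fun=> c).
Proof.
exists c%:MP; last by move=> f _; rewrite mevalC.
by rewrite -alg_mpolyC rpredZ // dhomog1.
Qed.

Lemma polyfunM k l phi psi :
  polyfun k phi -> polyfun l psi -> polyfun (k + l) (fun f => phi f * psi f).
Proof.
move=> [P hP PE] [Q hQ QE]; exists (P * Q); first exact: dhomogM.
by move=> f hf; rewrite mevalM PE ?QE.
Qed.

Lemma polyfun_sum (I : finType) (A : pred I) k (phi : I -> triple F -> F) :
  (forall i, A i -> polyfun k (phi i)) -> polyfun k (fun f => \sum_(i | A i) phi i f).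
Proof.
move=> h; suff : forall r : seq I, polyfun k (fun f => \sum_(i <- r | A i) phi i f) by apply.
elim=> [|i r IH].
  by apply: eq_polyfun (polyfun0 k) => f; rewrite big_nil.
case Ai : (A i); last by apply: eq_polyfun IH => f; rewrite big_cons Ai.
by apply: eq_polyfun (polyfunD (h i Ai) IH) => f; rewrite big_cons Ai.
Qed.

Lemma polyfun_prod n k (phi : 'I_n -> triple F -> F) :
  (forall i, polyfun k (phi i)) -> polyfun (n * k) (fun f => \prod_i phi i f).
Proof.
elim: n phi => [|n IH] phi h.
  by rewrite mul0n; apply: eq_polyfun (polyfunC 1) => f; rewrite big_ord0.
rewrite mulSn; apply: eq_polyfun (polyfunM (h ord0) (IH _ (fun i => h (lift ord0 i)))).
by move=> f; rewrite big_ord_recl.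
Qed.

Lemma polyfun_det n k (phi : 'I_n -> 'I_n -> triple F -> F) :
    (forall a b, polyfun k (phi a b)) ->
  polyfun (n * k) (fun f => \det (\matrix_(a, b) phi a b f)).
Proof.
move=> h; apply: polyfun_sum => s _; apply: polyfunZ.
have := @polyfun_prod n k (fun a => phi a (s a)) (fun a => h a (s a)).
by apply: eq_polyfun => f; apply: eq_bigr => a _; rewrite mxE.
Qed.

Lemma polyfun_coef i m : polyfun 1 (fun f => (f i)@_m).
Proof.
have [md|nmd] := eqVneq (mdeg m) d; last first.
  exists 0; first exact: rpred0.
  by move=> f hf; rewrite meval0 (dhomog_nemf_coeff (hf i)).
have ltm : (mdeg m < d.+1)%N by rewrite md.
have md' : mdeg (BMultinom ltm) == d by rewrite /= md.
pose a : cidx d := (i, Sub (BMultinom ltm) md').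
exists 'X_(enum_rank a); first exact: dhomogXU.
by move=> f hf; rewrite mevalXU /coords enum_rankK.
Qed.

Definition polyform k (Phi : triple F -> S) := forall m, polyfun k (fun f => (Phi f)@_m).

Lemma polyform_coord i : polyform 1 (fun f => f i).
Proof. by move=> m; apply: polyfun_coef. Qed.

Lemma polyformC p : polyform 0 (fun=> p).
Proof. by move=> m; apply: polyfunC. Qed.

Lemma polyformM k l Phi Psi :
  polyform k Phi -> polyform l Psi -> polyform (k + l) (fun f => Phi f * Psi f).
Proof.
move=> hP hQ m; apply: eq_polyfun; first by move=> f; rewrite mcoeffM.
by apply: polyfun_sum => a _; apply: polyfunM.
Qed.

Lemma polyformB k Phi Psi :
  polyform k Phi -> polyform k Psi -> polyform k (fun f => Phi f - Psi f).
Proof.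
move=> hP hQ m; apply: eq_polyfun (polyfunD (hP m) (polyfunZ (-1) (hQ m))) => f.
by rewrite mcoeffB mulN1r.
Qed.

Lemma polyform_sum (I : finType) k (Phi : I -> triple F -> S) :
  (forall i, polyform k (Phi i)) -> polyform k (fun f => \sum_i Phi i f).
Proof.
move=> h m; apply: eq_polyfun (polyfun_sum (A := predT) (fun i _ => h i m)) => f.
by rewrite raddf_sum.
Qed.

Lemma polyform_mderiv k Phi j : polyform k Phi -> polyform k (fun f => (Phi f)^`M(j)).
Proof.
move=> h m; apply: eq_polyfun (polyfunZ ((m j).+1)%:R (h (m + U_(j))%MM)) => f.
by rewrite mcoeff_deriv mulr_natl.
Qed.

Lemma polyform_jacdet : polyform 3 (@jacdet F).
Proof.
move=> m; apply: eq_polyfun; first by move=> f; rewrite jacdetE.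
have hA i j : polyform 1 (fun f => jac f i j).
  by apply: polyform_mderiv; apply: polyform_coord.
apply: (@polyform_sum _ 3) => j; apply: (@polyformM 1 2) => //.
by apply: polyformB; apply: (@polyformM 1 1).
Qed.

End PolynomialFunctions.

Section Macaulay.
Variable F : closedFieldType.
Notation S := {mpoly F[3]}.
Variable e : nat.
Implicit Types (g : 'I_3 -> S) (L : nat).

(** Row indices of the Macaulay matrix: a row is a form [g j] times a monomial of degree [L - e],
    expanded in the monomials of degree [L]. *)
Definition mac_idx L : finType := ('I_3 * 'I_#|monos 3 (L - e)|)%type.

Definition mac_row L g (r : 'I_#|mac_idx L|) : S :=
  'X_[mono (enum_val r).2] * g (enum_val r).1.

Definition mac_minor L (s : 'I_#|monos 3 L| -> 'I_#|mac_idx L|) g : F :=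
  \det (\matrix_(a, b) (mac_row g (s a))@_(mono b)).

Lemma dhomog_mac_row L g r : (e <= L)%N -> (forall j, g j \is e.-homog) ->
  @mac_row L g r \is L.-homog.
Proof.
move=> eL hg; rewrite -[L in L.-homog](subnK eL); apply: dhomogM => //.
by rewrite dhomogX /= mdeg_mono.
Qed.

(** An invertible minor writes each ['X_k ^+ L] as a combination of the [g j], so a common zero has
    all coordinates 0. Conversely, the Nullstellensatz puts all monomials of some degree [L] into
    the row space, and full column rank yields a nonzero maximal minor. *)
Lemma macaulay_minorP g : (0 < e)%N -> (forall j, g j \is e.-homog) ->
  (forall x, nonzero_pt x -> exists j, (g j).@[x] != 0) <->
  (exists L (s : 'I_#|monos 3 L| -> 'I_#|mac_idx L|), (e <= L)%N /\ mac_minor s g != 0).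
Proof.
move=> e0 hg; split=> [ncz|[L [s [eL]]]]; last first.
  rewrite /mac_minor; set M := \matrix_(a, b) _ => dM x [k xk].
  apply: NNPP => no; have gx j : (g j).@[x] = 0.
    by apply/eqP; apply: contraT => h; case: no; exists j.
  have MV : invmx M *m M = 1%:M by rewrite mulVmx // unitmxE unitfE.
  have [|a aE] := @mono_onto 3 L (U_(k) *+ L)%MM; first by rewrite mdegMn mdeg1 mul1n.
  suff : ('X_k ^+ L).@[x] = 0.
    by rewrite rmorphXn /= mevalXU => /eqP; rewrite expf_eq0 (negPf xk) andbF.
  have -> : 'X_k ^+ L = \sum_c invmx M a c *: mac_row g (s c) :> S.
    rewrite mpolyXn -aE.
    under eq_bigr => c _ do rewrite (form_expand (dhomog_mac_row (s c) eL hg)) scaler_sumr.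
    have inner b : \sum_c invmx M a c *: ((mac_row g (s c))@_(mono b) *: 'X_[mono b]) =
        (a == b)%:R *: 'X_[mono b] :> S.
      under eq_bigr do rewrite scalerA.
      rewrite -scaler_suml; have /matrixP/(_ a b) := MV; rewrite [LHS]mxE [RHS]mxE => <-.
      by congr (_ *: _); apply: eq_bigr => c _; rewrite [M c b]mxE.
    rewrite exchange_big /= (bigD1 a) //= inner eqxx scale1r big1 ?addr0 // => b ba.
    by rewrite inner eq_sym (negPf ba) scale0r.
  rewrite raddf_sum big1 // => c _ /=.
  by rewrite mevalZ mevalM gx !mulr0.
have [L [eL span]] := projective_nullstellensatz hg ncz.
have {}eL := eL ord0; exists L.
pose M := \matrix_(r < #|mac_idx L|, b < #|monos 3 L|) (mac_row g r)@_(mono b).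
have fullM : row_full M.
  apply/row_fullP.
  have rowP (a : 'I_#|monos 3 L|) : exists c : 'I_#|mac_idx L| -> F,
      'X_[mono a] = \sum_r c r *: mac_row g r.
    have [|A hA AE] := span 'X_[mono a]; first by rewrite dhomogX /= mdeg_mono.
    exists (fun r => (A (enum_val r).1)@_(mono (enum_val r).2)).
    pose phi (jb : mac_idx L) : S := (A jb.1)@_(mono jb.2) *: ('X_[mono jb.2] * g jb.1).
    transitivity (\sum_(r < #|mac_idx L|) phi (enum_val r)); last first.
      by apply: eq_bigr => r _; rewrite /phi /mac_row.
    rewrite -(big_enum_val phi) /= AE.
    rewrite -(pair_big predT predT (fun j b => (A j)@_(mono b) *: ('X_[mono b] * g j))) /=.
    apply: eq_bigr => j _; rewrite {1}(form_expand (hA j)) mulr_suml.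
    by apply: eq_bigr => b _; rewrite scalerAl.
  have /fin_all_exists [c cE] := rowP.
  exists (\matrix_(a, r) c a r); apply/matrixP => a b.
  have /(congr1 (mcoeff (mono b))) := cE a.
  rewrite !mxE mcoeffX (inj_eq (@mono_inj 3 L)) => ->; rewrite raddf_sum /=.
  by apply: eq_bigr => r _; rewrite !mxE mcoeffZ.
exists (fullrankfun fullM); split=> //.
have := fullrowsub_unit fullM; rewrite unitmxE unitfE /mac_minor.
by rewrite (_ : rowsub _ _ = \matrix_(a, b) (mac_row g (fullrankfun fullM a))@_(mono b)) //;
  apply/matrixP => a b; rewrite !mxE.
Qed.

End Macaulay.

Section OpenLocus.
Variable F : closedFieldType.
Hypothesis charF0 : [pchar F] =i pred0.

(** Two closed sets missing part of the curve have equations [p] and [q] not divisible by the prime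
    [jacdet f]. Nor is their product, so some point of the curve lies outside both sets. *)
Lemma crit_smooth_irreducible d (f : triple F) :
  (1 < d)%N -> End2 d f -> crit_smooth f -> crit_irreducible f.
Proof.
move=> d1 [hf _] sm A B [SA [_ AE]] [SB [_ BE]] cover.
have hJ := dhomog_jacdet hf; set m := (_ + _)%N in hJ.
have m1 : (1 < m)%N by rewrite /m; lia.
have sm' x : nonzero_pt x -> (jacdet f).@[x] = 0 -> exists j, ((jacdet f)^`M(j)).@[x] != 0.
  by move=> xn0 Jx; apply: sm.
have pJ := smooth_form_prime hJ (ltnW m1) sm'.
have Jz := smooth_partial_neq0 charF0 ord_max hJ m1 (smooth_gradient charF0 hJ (ltnW m1) sm').
have [_ _ JP] := pJ.
have witness (Z : ('I_3 -> F) -> Prop) SZ : (forall x, Z x <-> zero_locus SZ x) ->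
    ~ (forall x, crit_locus f x -> Z x) -> exists2 p, SZ p & ~ rdvd (jacdet f) p.
  move=> ZE nZ; apply: NNPP => no; apply: nZ => x [xn0 Jx]; apply/ZE; split=> // p Sp.
  apply: NNPP => px; apply: no; exists p => // -[c cE].
  by apply: px; rewrite cE mevalM Jx mulr0.
case: (classic (forall x, crit_locus f x -> A x)) => [|nA]; first by left.
case: (classic (forall x, crit_locus f x -> B x)) => [|nB]; first by right.
have [p Sp Jp] := witness A SA AE nA; have [q Sq Jq] := witness B SB BE nB.
have [|x [xn0 Jx]] := rprime_nonvanishing pJ Jz (h := p * q); first by case/JP.
rewrite mevalM mulf_eq0 negb_or => /andP[px qx].
by case: (cover x (conj xn0 Jx)) => [/AE|/BE] [_ z]; [move: px|move: qx];
  rewrite z // eqxx.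
Qed.

(** The Jacobian matrix is the matrix of the linear map, so a kernel vector would be a common
    zero. *)
Lemma linear_crit_locus (f : triple F) x : End2 1 f -> ~ crit_locus f x.
Proof.
move=> [hf fn0] [_]; rewrite /jacdet -det_map_mx => /eqP.
rewrite -det_tr => /det0P [v vn0 vA].
have [j vj] : exists j, v 0 j != 0.
  apply: NNPP => no; case/eqP: vn0; apply/rowP => j; rewrite mxE.
  by apply/eqP; apply: contraT => h; case: no; exists j.
have [|i] := fn0 (fun j => v 0 j); first by exists j.
have := euler_eval (fun j => v 0 j) (hf i); rewrite mul1r => <-.
have /matrixP/(_ 0 i) := vA; rewrite !mxE => sum0; case/negP; apply/eqP.
rewrite -[RHS]sum0; apply: eq_bigr => k _; rewrite !mxE /=.
by rewrite (dhomog_const (dhomog_mderiv k (hf i))) !mevalC.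
Qed.

Lemma Ed_linear (f : triple F) : End2 1 f -> Ed 1 f.
Proof.
move=> Ef; split=> //; split=> [x /linear_crit_locus []//|A B _ _ _].
by left=> x /linear_crit_locus [].
Qed.

Lemma open_in_End_linear : open_in_End 1 (Ed (F:=F) 1).
Proof.
split=> [f []//|]; exists (fun P => P = 1); split=> [P ->|f Ef].
  by exists 0%N; apply: dhomog1.
by split=> _; [exists 1; rewrite // meval1 oner_eq0 | apply: Ed_linear].
Qed.

Lemma open_in_End_Ed d : (1 < d)%N -> open_in_End d (Ed (F:=F) d).
Proof.
move=> d1; split=> [f []//|].
pose m := (d.-1 + (d.-1 + d.-1))%N; have m1 : (1 < m)%N by rewrite /m; lia.
pose grad (f : triple F) j := (jacdet f)^`M(j).
(* The minors of all degrees [L] are taken together; an open set needs no bound on [L]. *)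
exists (fun P => exists L (s : 'I_#|monos 3 L| -> 'I_#|mac_idx m.-1 L|),
  [/\ (m.-1 <= L)%N, exists k, P \is k.-homog
    & forall f, (forall i, f i \is d.-homog) -> mac_minor s (grad f) = P.@[@coords F d f]]).
split=> [P [L [s [_ hP _]]]//|f Ef]; have [hf _] := Ef.
have hJ := dhomog_jacdet hf.
have hg j : grad f j \is m.-1.-homog by apply: dhomog_mderiv.
have m0 : (0 < m.-1)%N by lia.
have macP := macaulay_minorP m0 hg.
split=> [[_ [sm _]]|[P [L [s [mL _ PE]]] Pf]].
  have [L [s [mL ms]]] : exists L (s : 'I_#|monos 3 L| -> 'I_#|mac_idx m.-1 L|),
      (m.-1 <= L)%N /\ mac_minor s (grad f) != 0.
    by apply/macP; apply: (smooth_gradient charF0 hJ (ltnW m1)) => x xn0 Jx; apply: sm.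
  (* The Jacobian determinant, and so each matrix entry, is cubic in the coefficients of [f]. *)
  have [P hP PE] : polyfun d (#|monos 3 L| * 3) (fun f => mac_minor s (grad f)).
    apply: polyfun_det => a b.
    apply: (@polyformM F d 0 3); first exact: polyformC.
    by apply: polyform_mderiv; apply: polyform_jacdet.
  exists P; last by rewrite -PE.
  by exists L, s; split=> //; exists (#|monos 3 L| * 3)%N.
have gradf : forall x, nonzero_pt x -> exists j, (grad f j).@[x] != 0.
  by apply/macP; exists L, s; rewrite PE.
have sm : crit_smooth f by move=> x [xn0 _]; apply: gradf.
by split=> //; split=> //; apply: crit_smooth_irreducible Ef sm.
Qed.

End OpenLocus.

(** * An explicit example *)

Section Example.
Variable F : closedFieldType.
Hypothesis charF0 : [pchar F] =i pred0.
Notation S := {mpoly F[3]}.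

Let natF_neq0 n : n.+1%:R != 0 :> F.
Proof. by rewrite (pcharf0P F).1. Qed.

Section Nondegenerate.
Variable e : nat.
Notation E := (e.+1%:R : F).
(** Put u_i = x_i^E and let s be the sum of the u_i. For the map below, Df is E + 1 times the sum of
    the diagonal matrix (E u_i + s) and the rank one matrix (E x_i x_j^(E-1)). Its determinant is (E
    + 1)^3 times prod_i (E u_i + s) + E sum_i u_i prod_(k != i) (E u_k + s), and [C], [B], [A] are
    the coefficients of e1^3, e1 e2, e3 in this sum. *)
Notation C := (2 * E + 1).
Notation B := (3 * E ^+ 2).
Notation A := (4 * E ^+ 3).

Let E0 : E != 0. Proof. exact: natF_neq0. Qed.
Let C0 : C != 0.
Proof. by rewrite -natrM natr1; apply: natF_neq0. Qed.
Let B0 : B != 0.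
Proof. by rewrite mulf_neq0 ?expf_neq0 //; apply: (natF_neq0 2). Qed.
Let A0 : A != 0.
Proof. by rewrite mulf_neq0 ?expf_neq0 //; apply: (natF_neq0 3). Qed.

(* [u_i K_i(u)] for [K = A e3 + B e1 e2 + C e1^3], with [e_j] the elementary
   symmetric functions of [u]. *)
Definition log_deriv (t u v w : F) :=
  t * (3 * C * (u + v + w) ^+ 2 + B * (u * v + u * w + v * w)
       + B * (u + v + w) ^+ 2 - B * (u + v + w) * t) + A * (u * v * w).

Lemma log_deriv_two u v :
  log_deriv u u v 0 = 0 -> log_deriv v u v 0 = 0 -> u = 0 /\ v = 0.
Proof.
rewrite /log_deriv => h1 h2.
have three : 3 * C != 0 :> F by rewrite mulf_neq0 //; apply: (natF_neq0 2).
have one t : 3 * C * t ^+ 3 = 0 -> t = 0.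
  by move/eqP; rewrite mulf_eq0 (negPf three) expf_eq0 /= => /eqP.
have [u0|u0] := eqVneq u 0.
  by split=> //; apply: one; rewrite -[RHS]h2 u0; ring.
have [v0|v0] := eqVneq v 0.
  by split=> //; apply: one; rewrite -[RHS]h1 v0; ring.
have e1 : 3 * C * (u + v) ^+ 2 + B * (u * v) + B * (u + v) ^+ 2 - B * (u + v) * u = 0.
  by apply: (mulfI u0); rewrite mulr0 -[RHS]h1; ring.
have e2 : 3 * C * (u + v) ^+ 2 + B * (u * v) + B * (u + v) ^+ 2 - B * (u + v) * v = 0.
  by apply: (mulfI v0); rewrite mulr0 -[RHS]h2; ring.
have : B * ((u + v) * (u - v)) = 0.
  by rewrite -[RHS](subrr 0) -{1}e2 -{1}e1; ring.
move/eqP; rewrite mulf_eq0 (negPf B0) /= mulf_eq0 => /orP[] /eqP uv.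
  have vE : v = - u by apply/eqP; rewrite -addr_eq0 addrC uv.
  move/eqP: e1; rewrite uv (_ : _ - _ = B * (u * v)); last by rewrite /=; ring.
  by rewrite mulf_eq0 (negPf B0) mulf_eq0 (negPf u0) (negPf v0).
have vE : v = u by apply/esym/eqP; rewrite -subr_eq0 uv.
(* The coefficient is 12 C + 3 B, written as a positive integer so that characteristic 0 applies. *)
have : (9 * e.+1 ^ 2 + 24 * e.+1 + 12)%:R * u ^+ 2 = 0 :> F.
  by rewrite -[RHS]e1 vE !natrD !natrM; ring.
by move/eqP; rewrite mulf_eq0 addnS (negPf (natF_neq0 _)) expf_eq0 (negPf u0) andbF.
Qed.

(** In its first argument t, [log_deriv] is the quadratic T t - B s t^2 + A u v w with coefficients
    symmetric in u, v, w. Two distinct roots [a], [b] give T = B s (a + b) and then 3 s + 4 E a = 0;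
    eliminating s leaves a positive multiple of E^2 a^2. *)
Lemma log_deriv_double a b : a != 0 -> b != 0 ->
  log_deriv a a a b = 0 -> log_deriv b a a b = 0 -> False.
Proof.
rewrite /log_deriv => a0 b0 h1 h2.
have [ba|ba] := eqVneq b a.
  have : (4 * e.+1 ^ 3 + 27 * e.+1 ^ 2 + 54 * e.+1 + 27)%:R * a ^+ 3 = 0 :> F.
    by rewrite -[RHS]h1 ba !natrD !natrM; ring.
  by move/eqP; rewrite mulf_eq0 addnS (negPf (natF_neq0 _)) expf_eq0 (negPf a0) andbF.
set s := a + a + b in h1 h2; set T := 3 * C * _ + _ + _ in h1 h2.
have ab : a - b != 0 by rewrite subr_eq0 eq_sym.
have t1 : T - B * s * (a + b) = 0.
  by apply: (mulfI ab); rewrite mulr0 -[RHS](subrr 0) -{1}h1 -{1}h2; ring.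
have Bs : 3 * s + 4 * E * a = 0.
  have nz : E ^+ 2 * (a * b) != 0 by rewrite !mulf_neq0 // expf_neq0.
  apply: (mulfI nz); rewrite mulr0 -[RHS](subrr 0) -{1}h1 -(mulr0 a) -t1; ring.
have : (4 * e.+1 + 11)%:R * (E ^+ 2 * a ^+ 2) = 0 :> F.
  have bE : b = s - a - a by rewrite /s; ring.
  have : C * s ^+ 2 + B * (a * s - a ^+ 2) = 0.
    apply: (mulfI (natF_neq0 2)); rewrite mulr0 -[RHS]t1 /T bE; ring.
  move=> t2.
  (* Division of the quadratic relation [t2] by 3 s + 4 E a; the left-hand side comes from
     substituting s = -4 E a / 3. *)
  have -> : (4 * e.+1 + 11)%:R * (E ^+ 2 * a ^+ 2) =
     (3 * s + 4 * E * a) * (3 * C * s - 4 * E * C * a + 3 * B * a)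
     - 9 * (C * s ^+ 2 + B * (a * s - a ^+ 2)).
    by rewrite natrD natrM; ring.
  by rewrite Bs t2 mul0r mulr0 subrr.
move/eqP; rewrite mulf_eq0 addnS (negPf (natF_neq0 _)) mulf_eq0 !expf_eq0 (negPf a0).
by rewrite (negPf E0).
Qed.

(** A quadratic with three distinct roots is zero, so its constant term A u v w vanishes. *)
Lemma log_deriv_distinct u v w : u != 0 -> v != 0 -> w != 0 ->
    u != v -> u != w -> v != w ->
    log_deriv u u v w = 0 -> log_deriv v u v w = 0 -> log_deriv w u v w = 0 ->
  False.
Proof.
rewrite /log_deriv => u0 v0 w0 uv uw vw h1 h2 h3.
set s := u + v + w in h1 h2 h3; set T := 3 * C * _ + _ + _ in h1 h2 h3.
have t1 : T - B * s * (u + v) = 0.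
  have nz : u - v != 0 by rewrite subr_eq0.
  by apply: (mulfI nz); rewrite mulr0 -[RHS](subrr 0) -{1}h1 -{1}h2; ring.
have t2 : T - B * s * (u + w) = 0.
  have nz : u - w != 0 by rewrite subr_eq0.
  by apply: (mulfI nz); rewrite mulr0 -[RHS](subrr 0) -{1}h1 -{1}h3; ring.
have s0 : s = 0.
  have nz : B * (v - w) != 0 by rewrite mulf_neq0 // subr_eq0.
  by apply: (mulfI nz); rewrite mulr0 -[RHS](subrr 0) -{1}t2 -{1}t1; ring.
have T0 : T = 0 by rewrite -t1 s0; ring.
move/eqP: h1; rewrite T0 s0 (_ : _ + _ = A * (u * v * w)); last by ring.
by rewrite mulf_eq0 (negPf A0) 2!mulf_eq0 (negPf u0) (negPf v0) (negPf w0).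
Qed.

Lemma log_deriv_zero u v w :
    log_deriv u u v w = 0 -> log_deriv v u v w = 0 -> log_deriv w u v w = 0 ->
  [/\ u = 0, v = 0 & w = 0].
Proof.
have C1 t a b c : log_deriv t a b c = log_deriv t b a c by rewrite /log_deriv; ring.
have C2 t a b c : log_deriv t a b c = log_deriv t a c b by rewrite /log_deriv; ring.
move=> h1 h2 h3.
have [w0|w0] := eqVneq w 0.
  by rewrite w0 in h1 h2 *; have [-> ->] := log_deriv_two h1 h2.
have [v0|v0] := eqVneq v 0.
  rewrite v0 C2 in h1; rewrite v0 C2 in h3.
  by have [_ ew] := log_deriv_two h1 h3; rewrite ew eqxx in w0.
have [u0|u0] := eqVneq u 0.
  rewrite u0 C1 C2 in h2; rewrite u0 C1 C2 in h3.
  by have [ev _] := log_deriv_two h2 h3; rewrite ev eqxx in v0.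
exfalso; have [uv|uv] := eqVneq u v.
  rewrite uv in h1; rewrite uv in h3.
  exact: (@log_deriv_double v w).
have [uw|uw] := eqVneq u w.
  rewrite -uw C2 in h1; rewrite -uw C2 in h2.
  exact: (@log_deriv_double u v).
have [vw|vw] := eqVneq v w.
  rewrite -vw C1 C2 in h1; rewrite -vw C1 C2 in h2.
  exact: (@log_deriv_double v u).
exact: (@log_deriv_distinct u v w).
Qed.

Lemma mderivXUn n (i j : 'I_3) :
  ('X_i ^+ n.+1 : S)^`M(j) = (n.+1%:R * (i == j)%:R) *: 'X_i ^+ n.
Proof.
rewrite !mpolyXn mderivX mulmnE mnm1E; have [->|_] := eqVneq i j.
  rewrite mul1n mulr1; congr (_ *: 'X_[_]); apply/mnmP => k.
  by rewrite mnmBE !mulmnE mnm1E; case: eqP => _; rewrite ?mul1n ?mul0n // subn1.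
by rewrite mul0n mulr0 !scale0r.
Qed.

Lemma mevalXUn n (i : 'I_3) x : ('X_i ^+ n : S).@[x] = x i ^+ n.
Proof. by rewrite rmorphXn /= mevalXU. Qed.

(** The two coefficients satisfy E + E^2 = E (E + 1), which lets E + 1 factor out of the whole
    Jacobian matrix. *)
Definition smooth_example : triple F := fun i =>
  'X_i * (E *: 'X_i ^+ e.+1 + (E + 1) *: \sum_j 'X_j ^+ e.+1).

Lemma meval_smooth_example x i :
  (smooth_example i).@[x] =
  x i * (E * x i ^+ e.+1 + (E + 1) * \sum_j x j ^+ e.+1).
Proof.
rewrite /smooth_example mevalM mevalXU mevalD 2!mevalZ mevalXUn.
by rewrite raddf_sum /=; under eq_bigr do rewrite mevalXUn.
Qed.

(** At a common zero each E u_i is 0 or -(E + 1) s. If the second value occurs c times, summation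
    gives (E + c (E + 1)) s = 0, so s = 0 and every u_i is 0. *)
Lemma End2_smooth_example : End2 e.+2 smooth_example.
Proof.
split=> [i|x xn0].
  have -> : e.+2 = (1 + e.+1)%N by [].
  apply: dhomogM; first exact: dhomogXU.
  rewrite rpredD // rpredZ ?dhomogXUn // rpred_sum // => j _; exact: dhomogXUn.
apply: NNPP => no.
have f0 i : (smooth_example i).@[x] = 0.
  by apply/eqP; apply: contraT => h; case: no; exists i.
pose u i := x i ^+ e.+1; pose s := \sum_j u j.
have uP i : E * u i = 0 \/ E * u i = - ((E + 1) * s).
  have /eqP := f0 i; rewrite meval_smooth_example mulf_eq0 => /orP[/eqP xi|/eqP h].
    by left; rewrite /u xi expr0n mulr0.
  by right; apply/eqP; rewrite -addr_eq0; apply/eqP.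
have s0 : s = 0.
  have sE : E * s = E * u o0 + E * u o1 + E * u o2 by rewrite /s sum3; ring.
  have nz (c : nat) : (e.+1 + c * e.+2)%:R != 0 :> F by rewrite addSn natF_neq0.
  have d1 : e.+2%:R = E + 1 :> F by rewrite natr1.
  have fin (c : nat) : E * s = - (c%:R * ((E + 1) * s)) -> s = 0.
    move=> h; apply: (mulfI (nz c)); rewrite mulr0 natrD natrM d1 mulrDl h; ring.
  by case: (uP o0) => e0; case: (uP o1) => e1; case: (uP o2) => e2;
    rewrite e0 e1 e2 in sE;
    first [apply: (fin 0%N); rewrite sE; ring | apply: (fin 1%N); rewrite sE; ring
          | apply: (fin 2%N); rewrite sE; ring | apply: (fin 3%N); rewrite sE; ring].
have [i] := xn0; have : E * u i = 0 by case: (uP i) => ->; rewrite // s0 mulr0 oppr0.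
by move/eqP; rewrite mulf_eq0 (negPf E0) expf_eq0 /= => /eqP->; rewrite eqxx.
Qed.

Lemma meval_jac_smooth_example x i j :
  (jac smooth_example i j).@[x] =
  (E + 1) * ((i == j)%:R * (E * (x i * x i ^+ e) + \sum_k x k * x k ^+ e)
             + E * x i * x j ^+ e).
Proof.
have sumX : (\sum_k 'X_k ^+ e.+1 : S)^`M(j) = E *: 'X_j ^+ e.
  rewrite raddf_sum (bigD1 j) //= mderivXUn eqxx mulr1 big1 ?addr0 // => k kj.
  by rewrite mderivXUn (negPf kj) mulr0 scale0r.
have dX : ('X_i : S)^`M(j) = (i == j)%:R%:MP.
  have := mderivXUn 0 i j; rewrite expr1 expr0 => ->.
  by rewrite mul1r alg_mpolyC.
rewrite /jac /smooth_example mderivM mderivD 2!mderivZ sumX mderivXUn dX.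
rewrite mevalD 2!mevalM 2!mevalD 6!mevalZ mevalC mevalXU !mevalXUn.
rewrite raddf_sum /=; under eq_bigr do rewrite mevalXUn exprS.
by rewrite exprS; case: eqP => [->|_] /=; ring.
Qed.

Definition cubic (U V W : S) : S :=
  (E + 1) ^+ 3 *: (C *: ((U + V + W) * (U + V + W) * (U + V + W))
    + B *: ((U + V + W) * (U * V + U * W + V * W)) + A *: (U * V * W)).

Lemma meval_cubic U V W x (u := U.@[x]) (v := V.@[x]) (w := W.@[x]) :
  (cubic U V W).@[x] =
  (E + 1) ^+ 3 * (C * (u + v + w) ^+ 3
    + B * ((u + v + w) * (u * v + u * w + v * w)) + A * (u * v * w)).
Proof. by rewrite /cubic !(mevalZ, mevalD, mevalM) -/u -/v -/w; ring. Qed.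

Lemma mderiv_cubic U V W k x (u := U.@[x]) (v := V.@[x]) (w := W.@[x])
    (u' := (U^`M(k)).@[x]) (v' := (V^`M(k)).@[x]) (w' := (W^`M(k)).@[x]) :
  ((cubic U V W)^`M(k)).@[x] =
  (E + 1) ^+ 3 * (3 * C * (u + v + w) ^+ 2 * (u' + v' + w')
    + B * ((u' + v' + w') * (u * v + u * w + v * w)
      + (u + v + w) * (u' * v + u * v' + u' * w + u * w' + v' * w + v * w'))
    + A * (u' * v * w + u * v' * w + u * v * w')).
Proof.
rewrite /cubic !(mderivZ, mderivD, mderivM) !(mevalZ, mevalD, mevalM).
by rewrite -/u -/v -/w -/u' -/v' -/w'; ring.
Qed.

Definition example_critical : S :=
  cubic ('X_o0 ^+ e.+1) ('X_o1 ^+ e.+1) ('X_o2 ^+ e.+1).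

Let neqo : [/\ o0 == o1 = false, o0 == o2 = false, o1 == o2 = false, o1 == o0 = false
  & (o2 == o0 = false) /\ (o2 == o1 = false)].
Proof. by split; [..|split]; rewrite -val_eqE /= !inordK. Qed.

Lemma meval_jacdet_smooth_example x (u := fun i => x i ^+ e.+1) :
  (jacdet smooth_example).@[x] =
  (E + 1) ^+ 3 * (C * (u o0 + u o1 + u o2) ^+ 3
    + B * ((u o0 + u o1 + u o2) * (u o0 * u o1 + u o0 * u o2 + u o1 * u o2))
    + A * (u o0 * u o1 * u o2)).
Proof.
have [n01 n02 n12 n10 [n20 n21]] := neqo.
pose M i j := (E + 1) * ((i == j)%:R * (E * (x i * x i ^+ e)
  + (x o0 * x o0 ^+ e + x o1 * x o1 ^+ e + x o2 * x o2 ^+ e)) + E * x i * x j ^+ e).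
have -> : (jacdet smooth_example).@[x] = det3 M.
  have MP i j : (jac smooth_example i j).@[x] = M i j.
    by rewrite meval_jac_smooth_example sum3.
  rewrite jacdetE meval_det3; apply: eq_bigr => j _; rewrite /cof.
  by congr (_ * (_ * _ - _ * _)); apply: MP.
rewrite /det3 sum3 /cof !nxE /M !eqxx n01 n02 n12 n10 n20 n21 /u !exprS /=; ring.
Qed.

Lemma jacdet_smooth_example : jacdet smooth_example = example_critical.
Proof.
apply: mpoly_eq_eval => x.
by rewrite meval_jacdet_smooth_example /example_critical meval_cubic 3!mevalXUn.
Qed.

(** The factor [x k] turns the derivative into a function of the powers x_i^E alone, which reduces
    smoothness to a statement about a plane cubic. *)
Lemma meval_example_partial x k :
  x k * (example_critical^`M(k)).@[x] =
  (E + 1) ^+ 3 * E *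
    log_deriv (x k ^+ e.+1) (x o0 ^+ e.+1) (x o1 ^+ e.+1) (x o2 ^+ e.+1).
Proof.
have [n01 n02 n12 n10 [n20 n21]] := neqo.
rewrite /example_critical mderiv_cubic 3!mderivXUn 3!mevalZ 6!mevalXUn.
rewrite !exprS /log_deriv.
by case: (ord3P k) => ->; rewrite ?eqxx ?n01 ?n02 ?n12 ?n10 ?n20 ?n21 /=; ring.
Qed.

Lemma crit_smooth_example : crit_smooth smooth_example.
Proof.
move=> x [xn0 _]; apply: NNPP => no.
have g0 j : (example_critical^`M(j)).@[x] = 0.
  rewrite -jacdet_smooth_example.
  by apply/eqP; apply: contraT => h; case: no; exists j.
have ld k : log_deriv (x k ^+ e.+1) (x o0 ^+ e.+1) (x o1 ^+ e.+1) (x o2 ^+ e.+1) = 0.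
  have nz : (E + 1) ^+ 3 * E != 0.
    by rewrite mulf_neq0 // expf_neq0 // natr1.
  by apply: (mulfI nz); rewrite mulr0 -meval_example_partial g0 mulr0.
have [z0 z1 z2] := log_deriv_zero (ld o0) (ld o1) (ld o2).
have root y : y ^+ e.+1 = 0 -> y = 0 :> F.
  by move/eqP; rewrite expf_eq0 /= => /eqP.
have [i] := xn0.
by case: (ord3P i) => ->; rewrite (root _ z0, root _ z1, root _ z2) eqxx.
Qed.

End Nondegenerate.

End Example.

Theorem theorem15 (F : closedFieldType) (charF0 : [pchar F] =i pred0) :
  (forall d : nat, (1 <= d)%N ->
     open_in_End d (Ed (F:=F) d) /\ exists f, Ed (F:=F) d f) /\
  (forall d : nat, (2 <= d)%N ->
     forall f, Ed (F:=F) d f -> ~ postcrit_periodic f) /\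
  (forall d : nat, (2 <= d)%N ->
     ~ dense_in_End d (fun f => End2 (F:=F) d f /\ postcrit_periodic f)).
Proof.
have partA d : (1 <= d)%N -> open_in_End d (Ed (F:=F) d) /\ exists f, Ed (F:=F) d f.
  case: d => [//|[_|e _]].
    split; first exact: open_in_End_linear.
    exists (fun i => 'X_i); apply: Ed_linear; split=> [i|x [i xi]].
      exact: dhomogXU.
    by exists i; rewrite mevalXU.
  split; first exact: open_in_End_Ed.
  have Ef := End2_smooth_example charF0 e; have sm := @crit_smooth_example F charF0 e.
  by exists (smooth_example F e); split=> //; split=> //; apply: crit_smooth_irreducible Ef sm.
have partB d : (2 <= d)%N -> forall f, Ed (F:=F) d f -> ~ postcrit_periodic f.
  by move=> d2 f [Ef [sm _]]; apply: smooth_critical_not_periodic Ef sm.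
split=> //; split=> // d d2 dense; have [op ne] := partA d (ltnW d2).
by have [f [Ef [_ per]]] := dense _ op ne; apply: partB Ef per.
Qed.
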